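(* A valued $R$-module $(M,v)$ is residually divisible and affinely maximal if and only if for all non-zero $z\in M$ and all non-zero $r\in R$ there exists $y\in M$, regular for $r$, such that $y.r=z$. In particular, $(M,v)$ is divisible (i.e. $M.r=M$ for every non-zero $r\in R$) whenever it is residually divisible and affinely maximal.
   Context: **Skew polynomials.** $(K,\varphi)$ is a field with a ring endomorphism $\varphi$ (write $a^{\varphi}=\varphi(a)$), assumed not of finite order in $\operatorname{End}(K)$. $R=K[t;\varphi]$ is the skew polynomial ring with commutation rule $at=ta^{\varphi}$ $(a\in K)$; every $r\in R$ is uniquely a finite sum $r=\sum_i t^ia_i$ with $a_i\in K$. The terms $t^ia_i$ with $a_i\neq0$ are the monomials of $r$; $t^ia_i$ has degree $i$. **$K$-chains.** A $K$-chain is a linear order $(\Delta,<)$ with top element $\infty$ and unary functions $\gamma\mapsto\gamma\cdot a$ $(a\in K)$ such that for all non-zero $a,b\in K$ and $\gamma,\delta\in\Delta\setminus\{\infty\}$: (1) $\gamma>\delta\Rightarrow\gamma\cdot a>\delta\cdot a$; (2) $\gamma\cdot ab=(\gamma\cdot a)\cdot b$; (3) $\gamma\cdot a>\gamma\Rightarrow\delta\cdot a>\delta$; (4) $\gamma\cdot(a\pm b)\ge\min\{\gamma\cdot a,\gamma\cdot b\}$; (5) $\gamma\cdot0=\infty$, $\gamma\cdot1=\gamma$, $\infty\cdot b=\infty$. **$R$-chains.** An $R$-chain is a $K$-chain with a unary function $\gamma\mapsto\gamma\cdot r$ for each $r\in R$ (extending those for $K$) such that: (1) $\cdot t$ is strictly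 increasing on $\Delta\setminus\{\infty\}$ and $\infty\cdot t=\infty$; (2) $\gamma\cdot ta=(\gamma\cdot t)\cdot a$ and $\gamma\cdot t^na=(\gamma\cdot t^{n-1})\cdot ta$ for $a\in K$; (3) $\gamma\cdot r=\min_i\{\gamma\cdot\mathbf m_i\}$ for all non-zero $r$ with monomials $\mathbf m_i$; (4) for monomials $\mathbf m_1,\mathbf m_2$ with $0\le\deg\mathbf m_2<\deg\mathbf m_1$ and $\gamma\ne\infty$: if $\gamma\cdot\mathbf m_1\le\gamma\cdot\mathbf m_2$ then $\delta\cdot\mathbf m_1<\delta\cdot\mathbf m_2$ for all $\delta<\gamma$. The set $\mathcal O_\Delta=\{a\in K:\gamma\cdot a\ge\gamma\text{ for all }\gamma\ne\infty\}$ is a valuation ring of $K$; its valuation $v_K$ is always assumed non-trivial. A potential jump of $r$ in $\Delta$ is a $\gamma\neq\infty$ with $\gamma\cdot\mathbf m_i=\gamma\cdot\mathbf m_j=\gamma\cdot r$ for two different monomials of $r$. **Valued modules.** A valued $R$-module $(M,v)$ is a right $R$-module $M$ (action written $x.r$) with a surjective map $v:M\to\Delta$ onto an $R$-chain $\Delta=v(M)$ such that $v(x\pm y)\ge\min\{v(x),v(y)\}$, $v(x)=\infty\iff x=0$, $v(x.a)=v(x)\cdot a$ for $a\in K$, and $v(x.t)=v(x)\cdot t$. An element $x\in M$ is regular for $r\in R$ if $v(x.r)=v(x)\cdot r$. An extension $M\subseteq N$ of valued modules is immediate if for every non-zero $x\in N$ there is $y\in M$ with $v(x-y)>v(y)$;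 it is affine if for every $x\in N$ there is a non-zero $r\in R$ with $x.r\in M$. $(M,v)$ is affinely maximal if it has no proper affine immediate extension. $(M,v)$ is residually divisible if (1) for all non-zero $z\in M$ there is $y\in M$ with $v(y.t-z)>v(z)$; (2) for all $r\in R$ with a unique potential jump $\gamma$ in $v(M)$ and all $z\in M$ of valuation $\gamma\cdot r$ there is $y\in M$ of valuation $\gamma$ with $v(z-y.r)>v(z)$. *)

(* Defs.v *)
From HB Require Import structures.
From mathcomp Require Import all_boot all_order all_algebra.

Set Implicit Arguments.
Unset Strict Implicit.
Unset Printing Implicit Defensive.

Import Order.TTheory GRing.Theory.
Local Open Scope ring_scope.

(* K[t; phi] with coefficients written on the right: the list of coefficients
   a_0, a_1, ... of p : {poly K} stands for \sum_i t^i a_i.  As a t = t phi(a),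
   (t^i a) (t^j b) = t^(i + j) (phi^j(a) b). *)
Definition skewpoly (K : fieldType) (phi : {rmorphism K -> K}) : Type :=
  {poly K}.

Section SkewPolyRing.

Variables (K : fieldType) (phi : {rmorphism K -> K}).

HB.instance Definition _ :=
  GRing.Zmodule.copy (skewpoly phi) {poly K}.

Lemma iter_rmorph0 n : iter n phi 0 = 0.
Proof. by elim: n => //= n ->; rewrite rmorph0. Qed.

Lemma iter_rmorph1 n : iter n phi 1 = 1.
Proof. by elim: n => //= n ->; rewrite rmorph1. Qed.

Lemma iter_rmorphD n x y : iter n phi (x + y) = iter n phi x + iter n phi y.
Proof. by elim: n => //= n ->; rewrite rmorphD. Qed.

Lemma iter_rmorphM n x y : iter n phi (x * y) = iter n phi x * iter n phi y.
Proof. by elim: n => //= n ->; rewrite rmorphM. Qed.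

Lemma iter_rmorph_sum n (I : finType) (P : pred I) (F : I -> K) :
  iter n phi (\sum_(i | P i) F i) = \sum_(i | P i) iter n phi (F i).
Proof.
exact: (big_morph (iter n phi) (iter_rmorphD n) (iter_rmorph0 n)).
Qed.

Definition skew_mul (p q : {poly K}) : {poly K} :=
  \poly_(k < (size p + size q).-1)
    \sum_(i < k.+1) iter (k - i) phi p`_i * q`_(k - i).

Lemma coef_skew_mul p q k :
  (skew_mul p q)`_k = \sum_(i < k.+1) iter (k - i) phi p`_i * q`_(k - i).
Proof.
rewrite coef_poly ltn_predRL; case: leqP => // le_pq_i1.
rewrite big1 // => j _; have [lq_p_j|lt_j_p] := leqP (size p) j.
  by rewrite nth_default // iter_rmorph0 mul0r.
rewrite [q`__]nth_default ?mulr0 // leq_subRL -ltnS //.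
by rewrite (leq_trans _ le_pq_i1) // ltn_add2r.
Qed.

Lemma coef_skew_mul_rev p q k :
  (skew_mul p q)`_k = \sum_(j < k.+1) iter j phi p`_(k - j) * q`_j.
Proof.
rewrite coef_skew_mul (reindex_inj rev_ord_inj) /=.
by apply: eq_bigr => j _; rewrite (sub_ordK j).
Qed.

Lemma skew_mulA : associative skew_mul.
Proof.
move=> p q r; apply/polyP=> i; rewrite coef_skew_mul coef_skew_mul_rev.
pose coef3 j k :=
  iter (i - j) phi p`_j * (iter k phi q`_(i - j - k)%N * r`_k).
transitivity (\sum_(j < i.+1) \sum_(k < i.+1 | (k <= i - j)%N) coef3 j k).
  apply: eq_bigr => /= j _; rewrite coef_skew_mul_rev big_distrr /=.
  by rewrite (big_ord_narrow_leq (leq_subr _ _)).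
rewrite (exchange_big_dep predT) //=; apply: eq_bigr => k _.
transitivity (\sum_(j < i.+1 | (j <= i - k)%N) coef3 j k).
  apply: eq_bigl => j; rewrite -ltnS -(ltnS j) -!subSn ?leq_ord //.
  by rewrite -subn_gt0 -(subn_gt0 j) -!subnDA addnC.
rewrite (big_ord_narrow_leq (leq_subr _ _)) coef_skew_mul.
rewrite iter_rmorph_sum big_distrl /=; apply: eq_bigr => j _.
rewrite /coef3 iter_rmorphM -iterD mulrA.
have le_k_i : (k <= i)%N by rewrite -ltnS.
have le_j : (j <= i - k)%N by rewrite -ltnS.
by rewrite addnBA // subnKC // -!subnDA [(k + j)%N]addnC.
Qed.

Lemma skew_mul1l : left_id (1 : {poly K}) skew_mul.
Proof.
move=> p; apply/polyP => i; rewrite coef_skew_mul big_ord_recl subn0 /=.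
rewrite coef1 iter_rmorph1 mul1r big1 ?addr0 // => j _.
by rewrite coef1 iter_rmorph0 mul0r.
Qed.

Lemma skew_mul1r : right_id (1 : {poly K}) skew_mul.
Proof.
move=> p; apply/polyP => i; rewrite coef_skew_mul_rev big_ord_recl subn0 /=.
rewrite coef1 mulr1 big1 ?addr0 // => j _.
by rewrite coef1 mulr0.
Qed.

Lemma skew_mulDl : left_distributive skew_mul +%R.
Proof.
move=> p q r; apply/polyP=> i; rewrite coefD !coef_skew_mul -big_split.
by apply: eq_bigr => j _; rewrite coefD iter_rmorphD mulrDl.
Qed.

Lemma skew_mulDr : right_distributive skew_mul +%R.
Proof.
move=> p q r; apply/polyP=> i; rewrite coefD !coef_skew_mul -big_split.
by apply: eq_bigr => j _; rewrite coefD mulrDr.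
Qed.

Lemma skew_1_neq0 : (1 : {poly K}) != 0.
Proof. exact: oner_neq0. Qed.

HB.instance Definition _ :=
  GRing.Zmodule_isNzRing.Build (skewpoly phi)
    skew_mulA skew_mul1l skew_mul1r skew_mulDl skew_mulDr skew_1_neq0.

Definition skewC (a : K) : skewpoly phi := a%:P.

Definition skewX : skewpoly phi := 'X.

Definition skew_coef (r : skewpoly phi) (i : nat) : K := (r : {poly K})`_i.

Definition skew_size (r : skewpoly phi) : nat := size (r : {poly K}).

Definition skew_mono (i : nat) (a : K) : skewpoly phi := skewX ^+ i * skewC a.

Lemma skewX_mul_coef (r : skewpoly phi) k :
  skew_coef (skewX * r) k = if k is k'.+1 then skew_coef r k' else 0.
Proof.
rewrite [LHS](coef_skew_mul 'X r); case: k => [|k].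
  by rewrite big_ord1 coefX mul0r.
rewrite (bigD1 (Ordinal (isT : (1 < k.+2)%N))) //= coefX eqxx iter_rmorph1.
rewrite mul1r subSS subn0 big1 ?addr0 // => i.
by rewrite -val_eqE /= coefX => /negPf->; rewrite iter_rmorph0 mul0r.
Qed.

Lemma mul_skewX_coef (r : skewpoly phi) k :
  skew_coef (r * skewX) k = if k is k'.+1 then phi (skew_coef r k') else 0.
Proof.
rewrite [LHS](coef_skew_mul_rev r 'X); case: k => [|k].
  by rewrite big_ord1 coefX /= mulr0.
rewrite (bigD1 (Ordinal (isT : (1 < k.+2)%N))) //= coefX eqxx mulr1.
rewrite subSS subn0 big1 ?addr0 // => i.
by rewrite -val_eqE /= coefX => /negPf->; rewrite mulr0.
Qed.

Lemma skew_commute (a : K) : skewC a * skewX = skewX * skewC (phi a).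
Proof.
apply/polyP => k.
rewrite -/(skew_coef _ k) -[RHS]/(skew_coef _ k) mul_skewX_coef skewX_mul_coef.
by case: k => [|[|k]] //; rewrite /skew_coef !coefC //= rmorph0.
Qed.

Lemma skew_coef_mono i a k : skew_coef (skew_mono i a) k = a *+ (k == i).
Proof.
elim: i k => [|i IH] k.
  by rewrite /skew_mono expr0 mul1r /skew_coef coefC; case: eqP.
by rewrite /skew_mono exprS -mulrA skewX_mul_coef; case: k => [|k] //; apply: IH.
Qed.

Lemma skew_monoE (r : skewpoly phi) :
  r = \sum_(i < skew_size r) skew_mono i (skew_coef r i).
Proof.
apply/polyP => k.
have coefS : {morph (fun p : skewpoly phi => skew_coef p k) : p q / p + q}.
  by move=> p q; apply: coefD.
rewrite -[RHS]/(skew_coef _ k) (big_morph _ coefS (id1 := 0) (coef0 _ _)).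
under eq_bigr => i _ do rewrite skew_coef_mono.
have [lt_k|le_k] := ltnP k (skew_size r).
  rewrite (bigD1 (Ordinal lt_k)) //= eqxx big1 ?addr0 // => i ne_ik.
  by rewrite (_ : (k == i) = false) //; apply: contraNF ne_ik => /eqP eq_ki;
     apply/eqP/val_inj.
rewrite nth_default // big1 // => i _.
by rewrite (_ : (k == i) = false) //; apply/gtn_eqF/(leq_trans (ltn_ord i)).
Qed.

End SkewPolyRing.

Arguments skewX {K phi}.
Arguments skewC {K phi} a.
Arguments skew_mono {K phi} i a.

Definition not_finite_order (K : fieldType) (phi : {rmorphism K -> K}) : Prop :=
  forall n : nat, (0 < n)%N -> ~ (iter n phi =1 id).

(* In all chains below the top element \top plays the role of infinity. *)

Record is_kchain (K : fieldType) (d : Order.disp_t) (D : tOrderType d)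
    (act : D -> K -> D) : Prop := IsKChain {
  kchain_mono : forall (a : K) (g h : D),
    a != 0 -> g != \top%O -> h != \top%O ->
    (h < g)%O -> (act h a < act g a)%O;
  kchain_actM : forall (a b : K) (g : D),
    a != 0 -> b != 0 -> g != \top%O -> act g (a * b) = act (act g a) b;
  kchain_gt : forall (a : K) (g h : D),
    a != 0 -> g != \top%O -> h != \top%O ->
    (g < act g a)%O -> (h < act h a)%O;
  kchain_actD : forall (a b : K) (g : D),
    a != 0 -> b != 0 -> g != \top%O ->
    (Order.min (act g a) (act g b) <= act g (a + b))%O;
  kchain_actB : forall (a b : K) (g : D),
    a != 0 -> b != 0 -> g != \top%O ->
    (Order.min (act g a) (act g b) <= act g (a - b))%O;
  kchain_act0 : forall g : D, act g 0 = \top%O;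
  kchain_act1 : forall g : D, act g 1 = g;
  kchain_top : forall b : K, act \top%O b = \top%O
}.

Definition in_valring (K : fieldType) (d : Order.disp_t) (D : tOrderType d)
    (act : D -> K -> D) (a : K) : Prop :=
  forall g : D, g != \top%O -> (g <= act g a)%O.

(* The iterated minimum has neutral element \top, so that restricting it to
   the non-zero coefficients gives the minimum over the monomials of r. *)
Record is_rchain (K : fieldType) (phi : {rmorphism K -> K})
    (d : Order.disp_t) (D : tOrderType d)
    (act : D -> skewpoly phi -> D) : Prop := IsRChain {
  rchain_kchain : is_kchain (fun (g : D) (a : K) => act g (skewC a));
  rchain_t_mono : forall g h : D, g != \top%O -> h != \top%O ->
    (g < h)%O -> (act g skewX < act h skewX)%O;
  rchain_t_top : act \top%O skewX = \top%O;
  rchain_ta : forall (g : D) (a : K),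
    act g (skewX * skewC a) = act (act g skewX) (skewC a);
  rchain_tna : forall (g : D) (n : nat) (a : K), (0 < n)%N ->
    act g (skewX ^+ n * skewC a)
      = act (act g (skewX ^+ n.-1)) (skewX * skewC a);
  rchain_min : forall (g : D) (r : skewpoly phi), r != 0 ->
    act g r = (\big[Order.min / \top]_(i < skew_size r | skew_coef r i != 0)
                 act g (skew_mono i (skew_coef r i)))%O;
  rchain_jump : forall (i j : nat) (a b : K) (g h : D),
    a != 0 -> b != 0 -> (j < i)%N -> g != \top%O ->
    (act g (skew_mono i a) <= act g (skew_mono j b))%O ->
    (h < g)%O ->
    (act h (skew_mono i a) < act h (skew_mono j b))%O
}.

Record rchain (K : fieldType) (phi : {rmorphism K -> K}) := RChain {
  rchain_disp : Order.disp_t;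
  rchain_order :> tOrderType rchain_disp;
  rchain_act : rchain_order -> skewpoly phi -> rchain_order;
  rchain_axioms : is_rchain rchain_act;
  rchain_nontrivial : exists a : K,
    ~ in_valring (fun (g : rchain_order) (b : K) => rchain_act g (skewC b)) a
}.

Definition potential_jump (K : fieldType) (phi : {rmorphism K -> K})
    (D : rchain phi) (r : skewpoly phi) (g : D) : Prop :=
  g != \top%O /\
  exists i j : nat,
    [/\ i != j, skew_coef r i != 0, skew_coef r j != 0,
        rchain_act g (skew_mono i (skew_coef r i)) = rchain_act g r
      & rchain_act g (skew_mono j (skew_coef r j)) = rchain_act g r].

(* Right modules over R are left modules over the converse ring R^c. *)
Definition ract (R : nzRingType) (M : lmodType R^c) (x : M) (r : R) : M :=
  (r : R^c) *: x.

Record is_valued (K : fieldType) (phi : {rmorphism K -> K})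
    (M : lmodType (skewpoly phi)^c) (D : rchain phi) (v : M -> D) : Prop :=
  IsValued {
  valued_surj : forall g : D, exists x : M, v x = g;
  valued_D : forall x y : M, (Order.min (v x) (v y) <= v (x + y))%O;
  valued_B : forall x y : M, (Order.min (v x) (v y) <= v (x - y))%O;
  valued_top : forall x : M, v x = \top%O <-> x = 0;
  valued_a : forall (x : M) (a : K),
    v (ract x (skewC a)) = rchain_act (v x) (skewC a);
  valued_t : forall x : M, v (ract x skewX) = rchain_act (v x) skewX
}.

Record valued_module (K : fieldType) (phi : {rmorphism K -> K}) :=
  ValuedModule {
  vm_module :> lmodType (skewpoly phi)^c;
  vm_chain : rchain phi;
  vm_val : vm_module -> vm_chain;
  vm_valued : is_valued vm_val
}.

Arguments vm_val {K phi v}.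

Definition regular (K : fieldType) (phi : {rmorphism K -> K})
    (M : valued_module phi) (r : skewpoly phi) (x : M) : Prop :=
  vm_val (ract x r) = rchain_act (vm_val x) r.

(* An inclusion M <= N of valued modules, as an embedding of modules together
   with the induced embedding of chains. *)
Record vm_extension (K : fieldType) (phi : {rmorphism K -> K})
    (M N : valued_module phi) := VMExtension {
  ext_emb :> {linear M -> N};
  ext_chain : vm_chain M -> vm_chain N;
  ext_emb_inj : injective ext_emb;
  ext_chain_mono : {mono ext_chain : g h / (g <= h)%O};
  ext_chain_top : ext_chain \top%O = \top%O;
  ext_chain_act : forall (g : vm_chain M) (r : skewpoly phi),
    ext_chain (rchain_act g r) = rchain_act (ext_chain g) r;
  ext_val : forall x : M, vm_val (ext_emb x) = ext_chain (vm_val x)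
}.

Definition immediate (K : fieldType) (phi : {rmorphism K -> K})
    (M N : valued_module phi) (f : vm_extension M N) : Prop :=
  forall x : N, x != 0 ->
    exists y : M, (vm_val (f y) < vm_val (x - f y))%O.

Definition affine (K : fieldType) (phi : {rmorphism K -> K})
    (M N : valued_module phi) (f : vm_extension M N) : Prop :=
  forall x : N,
    exists2 r : skewpoly phi, r != 0 & exists y : M, ract x r = f y.

Definition affinely_maximal (K : fieldType) (phi : {rmorphism K -> K})
    (M : valued_module phi) : Prop :=
  forall (N : valued_module phi) (f : vm_extension M N),
    affine f -> immediate f -> forall x : N, exists y : M, x = f y.

Definition residually_divisible (K : fieldType) (phi : {rmorphism K -> K})
    (M : valued_module phi) : Prop :=
  (forall z : M, z != 0 ->
     exists y : M, (vm_val z < vm_val (ract y skewX - z))%O) /\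
  (forall (r : skewpoly phi) (g : vm_chain M),
     potential_jump r g ->
     (forall h : vm_chain M, potential_jump r h -> h = g) ->
     forall z : M, vm_val z = rchain_act g r ->
       exists y : M, vm_val y = g /\ (vm_val z < vm_val (z - ract y r))%O).

Definition divisible (K : fieldType) (phi : {rmorphism K -> K})
    (M : valued_module phi) : Prop :=
  forall r : skewpoly phi, r != 0 -> forall z : M, exists y : M, ract y r = z.

(* Main.v *)
Require Import Defs.
From HB Require Import structures.
From mathcomp Require Import all_boot all_order all_algebra.
From mathcomp Require Import boolp classical_sets.

Set Implicit Arguments.
Unset Strict Implicit.
Unset Printing Implicit Defensive.

Import Order.TTheory GRing.Theory.
Local Open Scope ring_scope.

(** Why the theorem holds.  Write u . r for the action, on elements and on
    values alike.

    Suppose first that every equation y . r = z has a regular solution.  A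
    regular solution of an equation whose right-hand side has value g . r has
    value g, because g |-> g . r is strictly increasing ([chain_lt]); this gives
    residual divisibility.  For affine maximality, an element x of an affine
    immediate extension satisfies x . r = y . r for some y in M, so it is enough
    to place the r-torsion of the extension in M.  The value of a non-zero
    torsion element is a potential jump of r, since elsewhere a single monomial
    dominates; and r has finitely many potential jumps, since each pair of
    monomials crosses at most once ([finitely_many_jumps]).  An r-torsion
    element can be moved by an element of M to an r-torsion element of larger
    value, so the process ends at 0 ([torsion_in_image]).

    Conversely let M be residually divisible and affinely maximal.  By induction
    on the degree of r, equations of smaller degree have regular solutions.
    Residual divisibility yields for each w a y with v(y) . r = v(w) and
    v(w - y . r) > v(w) ([approx_solution]): it need only be applied to the
    part of r formed by the monomials that are minimal at the relevant value,
    and that part has at most one potential jump.  So if y . r = z has no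
    regular solution, approximate solutions can be improved for ever,
      and Zorn's lemma
    gives a maximal chain C of them, which plays the role of a
    pseudo-convergent sequence without limit ([approximating_chain_exists]).

    A formal solution x is then adjoined: N is the quotient of M (+) R by the
    submodule generated by (-z, r), and by division each of its elements is
    uniquely m + x . s with deg s < deg r.  The key fact is that for such a pair
    v(m + y . s) is eventually constant along C ([approx_stabilizes]).
    Indeed, by induction, for each y in C there is b such that b . s = -m and
    y - b is regular for s.  If each of these b were as close to its y as a
    limit of C would be, then, C having no limit, the differences of elements b
    attached to ever later y would be s-torsion elements of infinitely many
    values, against the finiteness of the jumps of s.  So some y - b has a
    constant value for the later y, and its regularity passes this on to
    (y - b) . s = m + y . s.  The eventual value is a valuation on N.
    The only delicate compatibility is with t ([eventual_X]), where reducing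
    s t modulo r changes the element by (z - y . r) . c, of strictly increasing
    value; as both other terms have eventually constant values, this term cannot
    matter.  N is immediate over M
    because m + y . s approximates m + x . s for y far in C, and affine because
    N / M has finite K-dimension.  By maximality x lies in M, which the
    uniqueness of m + x . s forbids. *)

(** * Division in the skew polynomial ring *)

Section SkewPolynomials.

Variables (K : fieldType) (phi : {rmorphism K -> K}).
Implicit Types (p q r s : skewpoly phi) (a b c : K).

Lemma skew_coefD p q k : skew_coef (p + q) k = skew_coef p k + skew_coef q k.
Proof. exact: coefD. Qed.

Lemma skew_coefB p q k : skew_coef (p - q) k = skew_coef p k - skew_coef q k.
Proof. exact: coefB. Qed.

Lemma skew_coef0 k : skew_coef (0 : skewpoly phi) k = 0.
Proof. exact: coef0. Qed.

Lemma skew_coef_sum (I : Type) (e : seq I) (P : pred I)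
    (F : I -> skewpoly phi) k :
  skew_coef (\sum_(i <- e | P i) F i) k = \sum_(i <- e | P i) skew_coef (F i) k.
Proof.
exact: (big_morph (fun p => skew_coef p k) (fun p q => skew_coefD p q k)
                  (skew_coef0 k)).
Qed.

Lemma skew_polyP p q : (forall k, skew_coef p k = skew_coef q k) -> p = q.
Proof. by move=> eq_pq; apply/polyP => k; apply: eq_pq. Qed.

Lemma skew_coef_default p k : (skew_size p <= k)%N -> skew_coef p k = 0.
Proof. exact: nth_default. Qed.

Lemma skew_coef_lt p k : skew_coef p k != 0 -> (k < skew_size p)%N.
Proof. by apply: contraNT; rewrite -leqNgt => /skew_coef_default ->. Qed.

Lemma skew_size_leP p n :
  (skew_size p <= n)%N <-> (forall k, (n <= k)%N -> skew_coef p k = 0).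
Proof.
split=> [le_pn k le_nk|p0]; first exact/skew_coef_default/(leq_trans le_pn).
by apply/leq_sizeP => k; apply: p0.
Qed.

Lemma skew_size_eq0 p : (skew_size p == 0)%N = (p == 0).
Proof. exact: size_poly_eq0. Qed.

Lemma skew_size0 : skew_size (0 : skewpoly phi) = 0%N.
Proof. exact: size_poly0. Qed.

Lemma skew_size1 : skew_size (1 : skewpoly phi) = 1%N.
Proof. exact: size_poly1. Qed.

Lemma skew_size_gt0 p : (0 < skew_size p)%N = (p != 0).
Proof. by rewrite lt0n skew_size_eq0. Qed.

Lemma skew_lead_neq0 p : p != 0 -> skew_coef p (skew_size p).-1 != 0.
Proof. by rewrite -lead_coef_eq0. Qed.

Lemma skew_sizeD p q n :
  (skew_size p < n)%N -> (skew_size q < n)%N -> (skew_size (p + q)%R < n)%N.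
Proof.
case: n => // n; rewrite !ltnS => /skew_size_leP p0 /skew_size_leP q0.
by apply/skew_size_leP => k le_nk; rewrite skew_coefD p0 // q0 // addr0.
Qed.

Lemma skew_sizeN p : skew_size (- p) = skew_size p.
Proof. exact: size_polyN. Qed.

Lemma skewC0 : skewC 0 = 0 :> skewpoly phi.
Proof. exact: polyC0. Qed.

Lemma skewC1 : skewC 1 = 1 :> skewpoly phi.
Proof. exact: polyC1. Qed.

Lemma skew_mono0 i : skew_mono i 0 = 0 :> skewpoly phi.
Proof. by rewrite /skew_mono skewC0 mulr0. Qed.

Lemma skew_size1E r : skew_size r = 1%N -> r = skewC (skew_coef r 0).
Proof. by rewrite /skew_size => sz; apply: size1_polyC; rewrite sz. Qed.

Lemma skew_coef_neq0 p i : skew_coef p i != 0 -> p != 0.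
Proof. by apply: contra_neq => ->; rewrite skew_coef0. Qed.

Lemma skewX_neq0 : skewX != 0 :> skewpoly phi.
Proof. by rewrite -skew_size_gt0 /skew_size size_polyX. Qed.

Lemma mul_skewC_coef p c k : skew_coef (p * skewC c) k = skew_coef p k * c.
Proof.
rewrite [LHS](coef_skew_mul_rev phi p (skewC c : {poly K})).
rewrite big_ord_recl subn0 /=.
rewrite coefC /= big1 ?addr0 // => j _; rewrite coefC /= mulr0 //.
Qed.

Lemma skewC_mul a b : skewC (a * b) = skewC a * skewC b :> skewpoly phi.
Proof.
by apply: skew_polyP => k; rewrite mul_skewC_coef /skew_coef !coefC; case: eqP;
  rewrite ?mul0r.
Qed.

Lemma mul_skew_mono_coef p c k j :
  skew_coef (p * skew_mono k c) (j + k) = iter k phi (skew_coef p j) * c.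
Proof.
rewrite /skew_mono mulrA mul_skewC_coef; congr (_ * _).
elim: k => [|k IH]; first by rewrite expr0 mulr1 addn0.
by rewrite exprSr mulrA addnS mul_skewX_coef IH.
Qed.

Lemma iter_rmorph_eq0 k a : (iter k phi a == 0) = (a == 0).
Proof. by elim: k => //= k <-; rewrite fmorph_eq0. Qed.

(** Injectivity of phi keeps the leading coefficient of the product non-
    zero: it is the product of a twist of one leading coefficient with the
    other. *)
Lemma skew_size_mul r q : q != 0 -> (skew_size r <= skew_size (r * q)%R)%N.
Proof.
move=> q0; have [->|r0] := eqVneq r 0; first by rewrite skew_size0.
have [n sz_r] : exists n, skew_size r = n.+1.
  by case: (skew_size r) (skew_size_gt0 r) r0 => [<- //|n _ _]; exists n.
have [d sz_q] : exists d, skew_size q = d.+1.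
  by case: (skew_size q) (skew_size_gt0 q) q0 => [<- //|d _ _]; exists d.
have := skew_lead_neq0 q0; have := skew_lead_neq0 r0.
rewrite sz_r sz_q /= => rn qd.
suff: skew_coef (r * q) (n + d) != 0.
  by move=> /skew_coef_lt; apply: leq_trans; rewrite ltnS leq_addr.
rewrite [skew_coef _ _](coef_skew_mul phi r q).
have lt_n : (n < (n + d).+1)%N by rewrite ltnS leq_addr.
rewrite (bigD1 (Ordinal lt_n)) //= big1 ?addr0 => [|i].
  by rewrite addKn mulf_neq0 // iter_rmorph_eq0.
rewrite -val_eqE /= neq_ltn => /orP[lt_in|lt_ni]; last first.
  by rewrite (_ : r`_i = 0) ?iter_rmorph0 ?mul0r //; apply: skew_coef_default;
    rewrite sz_r.
rewrite (_ : q`_(n + d - i) = 0) ?mulr0 //; apply: skew_coef_default.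
by rewrite sz_q -addnBAC ?(ltnW lt_in) // -add1n leq_add2r subn_gt0.
Qed.

Lemma skew_size_mulC p c : (skew_size (p * skewC c)%R <= skew_size p)%N.
Proof.
by apply/skew_size_leP => k le_k;
  rewrite mul_skewC_coef skew_coef_default ?mul0r.
Qed.

Lemma skew_size_mulX p : (skew_size (p * skewX)%R <= (skew_size p).+1)%N.
Proof.
apply/skew_size_leP => -[//|k] le_k.
by rewrite mul_skewX_coef skew_coef_default ?rmorph0.
Qed.

(** The one-step form of division. It is stated separately because for k = 0
    it provides a constant quotient, which is what the valuation of the
    adjoined element needs. *)
Lemma skew_cancel_lead r p k : r != 0 -> (skew_size p <= skew_size r + k)%N ->
  exists c, (skew_size (p - r * skew_mono k c)%R < skew_size r + k)%N.
Proof.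
move=> r0; have := skew_lead_neq0 r0; have := skew_size_gt0 r; rewrite r0.
case sz_r : (skew_size r) => [//|n] _ /= rn le_p.
have rn' : iter k phi (skew_coef r n) != 0 by rewrite iter_rmorph_eq0.
exists ((iter k phi (skew_coef r n))^-1 * skew_coef p (n + k)).
rewrite addSn ltnS; apply/skew_size_leP => j le_j; rewrite skew_coefB.
have ->: j = ((j - k) + k)%N by rewrite subnK // (leq_trans _ le_j) ?leq_addl.
rewrite mul_skew_mono_coef; move: le_j; rewrite leq_eqVlt => /orP[/eqP <-|lt_j].
  by rewrite addnK mulVKf ?subrr.
have -> : skew_coef r (j - k) = 0.
  by apply: skew_coef_default; rewrite sz_r ltn_subRL addnC.
rewrite iter_rmorph0 mul0r subr0 skew_coef_default //.
by rewrite subnK ?(leq_trans le_p) // (leq_trans _ (ltnW lt_j)) ?leq_addl.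
Qed.

Lemma skew_division r p : r != 0 ->
  exists q, (skew_size (p - r * q)%R < skew_size r)%N.
Proof.
move=> r0; have r_gt0 : (0 < skew_size r)%N by rewrite skew_size_gt0.
suff div k p' : (skew_size p' < skew_size r + k)%N ->
    exists q, (skew_size (p' - r * q)%R < skew_size r)%N.
  by apply: (div (skew_size p)); rewrite -add1n leq_add2r.
elim: k p' => [|k IH] p'; first by rewrite addn0 => lt_p; exists 0;
  rewrite mulr0 subr0.
rewrite addnS ltnS => /(skew_cancel_lead r0)[c /IH[q lt_q]].
by exists (skew_mono k c + q); rewrite mulrDr opprD addrA.
Qed.

End SkewPolynomials.

(** * Right actions *)

Section RightModules.

Variables (R : nzRingType) (M : lmodType R^c).
Implicit Types (x y : M) (p q : R).

Lemma ractM x p q : ract x (p * q) = ract (ract x p) q.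
Proof. by rewrite /ract scalerA. Qed.

Lemma ract1 x : ract x 1 = x.
Proof. exact: scale1r. Qed.

Lemma ract0 x : ract x 0 = 0.
Proof. exact: scale0r. Qed.

Lemma ractD x p q : ract x (p + q) = ract x p + ract x q.
Proof. exact: scalerDl. Qed.

Lemma ractBr x p q : ract x (p - q) = ract x p - ract x q.
Proof. exact: scalerBl. Qed.

Lemma ract_sum x (I : Type) (e : seq I) (P : pred I) (F : I -> R) :
  ract x (\sum_(i <- e | P i) F i) = \sum_(i <- e | P i) ract x (F i).
Proof. exact: scaler_suml. Qed.

Lemma ract0l p : ract (0 : M) p = 0.
Proof. exact: scaler0. Qed.

Lemma ractDl x y p : ract (x + y) p = ract x p + ract y p.
Proof. exact: scalerDr. Qed.

Lemma ractNl x p : ract (- x) p = - ract x p.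
Proof. exact: scalerN. Qed.

Lemma ractBl x y p : ract (x - y) p = ract x p - ract y p.
Proof. exact: scalerBr. Qed.

End RightModules.
(** * Monotonicity and potential jumps in chains *)

Section Chains.

Variables (K : fieldType) (phi : {rmorphism K -> K}) (D : rchain phi).
Implicit Types (g h e : D) (r : skewpoly phi) (a : K) (i j : nat).

Local Notation "g ∙ r" := (rchain_act g r) (at level 40, left associativity).

Let axD := rchain_axioms D.
Let axK := rchain_kchain axD.

Lemma chain_actV a g : a != 0 -> g ∙ skewC a ∙ skewC a^-1 = g.
Proof.
move=> a0; have [->|g_fin] := eqVneq g \top%O;
  first by rewrite !(kchain_top axK).
rewrite -(kchain_actM axK) ?invr_neq0 // divff //; exact: (kchain_act1 axK).
Qed.

Lemma chain_C_fin a g : a != 0 -> g != \top%O -> g ∙ skewC a != \top%O.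
Proof.
move=> a0; apply: contra_neq => ga; rewrite -(chain_actV g a0) ga.
exact: (kchain_top axK).
Qed.

Lemma lt_fin g h : (g < h)%O -> g != \top%O.
Proof. by move=> lt_gh; rewrite lt_eqF // (lt_le_trans lt_gh). Qed.

Lemma chain_C_lt a g h :
  a != 0 -> (g < h)%O -> (g ∙ skewC a < h ∙ skewC a)%O.
Proof.
move=> a0 lt_gh; have g_fin := lt_fin lt_gh.
have [->|h_fin] := eqVneq h \top%O; last exact: (kchain_mono axK).
by rewrite (kchain_top axK) lt_neqAle lex1 chain_C_fin.
Qed.

(** This is where the non-triviality of the valuation of K enters: an
    inverse of an element outside the valuation ring moves every finite
    value up. *)
Lemma chain_no_max g : g != \top%O -> exists2 h, h != \top%O & (g < h)%O.
Proof.
move=> g_fin; have [a na] := rchain_nontrivial D.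
have [h [h_fin lt_ha]] : exists h, h != \top%O /\ (h ∙ skewC a < h)%O.
  apply: contrapT => no_h; apply: na => h h_fin; rewrite leNgt.
  by apply/negP => lt_ha; apply: no_h; exists h.
have a0 : a != 0.
  apply: contraTneq lt_ha => ->; rewrite (kchain_act0 axK) -leNgt; exact: lex1.
have a0' := invr_neq0 a0.
exists (g ∙ skewC a^-1); first exact: chain_C_fin.
apply: (kchain_gt axK a0' h_fin g_fin).
rewrite -[X in (X < _)%O](chain_actV h a0); exact: chain_C_lt.
Qed.

(** Strict monotonicity of t alone would allow a largest finite value to be
    sent to infinity; the absence of such a value excludes it. *)
Lemma chain_X_fin g : g != \top%O -> g ∙ skewX != \top%O.
Proof.
move=> g_fin; have [h h_fin lt_gh] := chain_no_max g_fin.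
exact: lt_fin (rchain_t_mono axD g_fin h_fin lt_gh).
Qed.

Lemma chain_X_lt g h : (g < h)%O -> (g ∙ skewX < h ∙ skewX)%O.
Proof.
move=> lt_gh; have g_fin := lt_fin lt_gh.
have [->|h_fin] := eqVneq h \top%O; last exact: (rchain_t_mono axD).
by rewrite (rchain_t_top axD) lt_neqAle lex1 chain_X_fin.
Qed.

Lemma chain_monoS i a g :
  g ∙ skew_mono i.+1 a = g ∙ skewX ^+ i ∙ skewX ∙ skewC a.
Proof. by rewrite /skew_mono (rchain_tna axD) //= (rchain_ta axD). Qed.

Lemma chain_exprS i g : g ∙ skewX ^+ i.+1 = g ∙ skewX ^+ i ∙ skewX.
Proof.
have := chain_monoS i 1 g; rewrite /skew_mono skewC1 mulr1 => ->.
by have := kchain_act1 axK (g ∙ skewX ^+ i ∙ skewX); rewrite skewC1.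
Qed.

Lemma chain_monoE i a g : g ∙ skew_mono i a = g ∙ skewX ^+ i ∙ skewC a.
Proof.
case: i => [|i]; last by rewrite chain_monoS chain_exprS.
rewrite /skew_mono expr0 mul1r; congr (_ ∙ _).
by have := kchain_act1 axK g; rewrite skewC1.
Qed.

Lemma chain_expr_lt i g h :
  (g < h)%O -> (g ∙ skewX ^+ i < h ∙ skewX ^+ i)%O.
Proof.
elim: i g h => [|i IH] g h lt_gh; last by rewrite !chain_exprS chain_X_lt ?IH.
by have := kchain_act1 axK; rewrite skewC1 expr0 => act1; rewrite !act1.
Qed.

Lemma chain_mono_lt i a g h : a != 0 -> (g < h)%O ->
  (g ∙ skew_mono i a < h ∙ skew_mono i a)%O.
Proof. by move=> a0 lt_gh; rewrite !chain_monoE chain_C_lt ?chain_expr_lt. Qed.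

Lemma chain_mono_le i a g h : a != 0 -> (g <= h)%O ->
  (g ∙ skew_mono i a <= h ∙ skew_mono i a)%O.
Proof.
move=> a0; case: (ltgtP g h) => // [lt_gh _|-> _ //].
by rewrite ltW // chain_mono_lt.
Qed.

Lemma chain_mono_inj i a : a != 0 -> injective (fun g => g ∙ skew_mono i a).
Proof.
move=> a0 g h eq_gh; case: (ltgtP g h) => // /(chain_mono_lt i a0);
  by rewrite eq_gh ltxx.
Qed.

Lemma chain_mono_top i a : \top%O ∙ skew_mono i a = \top%O :> D.
Proof.
have expr_top : \top%O ∙ skewX ^+ i = \top%O :> D.
  elim: i => [|i IH]; last by rewrite chain_exprS IH (rchain_t_top axD).
  by have := kchain_act1 axK \top%O; rewrite skewC1 expr0.
by rewrite chain_monoE expr_top (kchain_top axK).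
Qed.

Lemma chain_act_le r g i : skew_coef r i != 0 ->
  (g ∙ r <= g ∙ skew_mono i (skew_coef r i))%O.
Proof.
move=> ri; have lt_i := skew_coef_lt ri.
rewrite (rchain_min axD); last by rewrite -skew_size_gt0 (leq_ltn_trans _ lt_i).
by rewrite (bigD1 (Ordinal lt_i)) //= ge_min lexx.
Qed.

Lemma chain_act_attained r g : r != 0 ->
  exists2 i, skew_coef r i != 0 & g ∙ r = g ∙ skew_mono i (skew_coef r i).
Proof.
move=> r0; pose F i := g ∙ skew_mono i (skew_coef r i).
have: g ∙ r = \top%O \/
    exists2 i : 'I_(skew_size r), skew_coef r i != 0 & g ∙ r = F i.
  rewrite (rchain_min axD) //; elim/big_ind: _; first by left.
  - move=> x y; rewrite minEle; by case: ifP => _ ? ?.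
  - by move=> i ri; right; exists i.
case=> [g_top|[i ri eq_i]]; last by exists i.
exists (skew_size r).-1; first exact: skew_lead_neq0.
by apply/esym/eqP; rewrite g_top -le1x -g_top chain_act_le ?skew_lead_neq0.
Qed.

Lemma chain_act_top r : \top%O ∙ r = \top%O :> D.
Proof.
have [->|r0] := eqVneq r 0; first by rewrite -skewC0 (kchain_act0 axK).
by have [i _ ->] := chain_act_attained \top%O r0; rewrite chain_mono_top.
Qed.

Lemma chain_lt r g h : r != 0 -> (g < h)%O -> (g ∙ r < h ∙ r)%O.
Proof.
move=> r0 lt_gh; have [i ri ->] := chain_act_attained h r0.
exact: le_lt_trans (chain_act_le _ ri) (chain_mono_lt _ ri lt_gh).
Qed.

Lemma chain_ltE r g h : r != 0 -> (g ∙ r < h ∙ r)%O = (g < h)%O.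
Proof.
move=> r0; apply/idP/idP; last exact: chain_lt.
by apply: contraTT; rewrite -!leNgt le_eqVlt
  => /orP[/eqP-> //|/(chain_lt r0)/ltW].
Qed.

Lemma chain_leE r g h : r != 0 -> (g ∙ r <= h ∙ r)%O = (g <= h)%O.
Proof. by move=> r0; rewrite !leNgt chain_ltE. Qed.

Lemma chain_inj r : r != 0 -> injective (fun g => g ∙ r).
Proof.
move=> r0 g h eq_gh; apply/eqP.
by rewrite eq_le -(chain_leE g h r0) -(chain_leE h g r0) eq_gh lexx.
Qed.

Lemma chain_act_fin r g : r != 0 -> g != \top%O -> g ∙ r != \top%O.
Proof.
move=> r0; apply: contra_neq => gr; apply: (chain_inj r0).
by rewrite /= gr chain_act_top.
Qed.

(** Below a crossing point the monomial of larger degree is strictly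
    smaller, so two crossing points would contradict each other. *)
Lemma crossing_unique i j a b g h : a != 0 -> b != 0 -> i != j ->
  g != \top%O -> h != \top%O ->
  g ∙ skew_mono i a = g ∙ skew_mono j b ->
  h ∙ skew_mono i a = h ∙ skew_mono j b -> g = h.
Proof.
wlog lt_ji : i j a b / (j < i)%N => [IH a0 b0 ne_ij|].
  have [lt_ji|lt_ij|eq_ij] := ltngtP j i; first exact: IH.
  - by move=> gf hf eqg eqh; apply: (IH j i b a); rewrite // eq_sym.
  - by rewrite eq_ij eqxx in ne_ij.
move=> a0 b0 _ g_fin h_fin eqg eqh.
case: (ltgtP g h) => // lt_gh.
- have := rchain_jump axD a0 b0 lt_ji h_fin _ lt_gh.
  by rewrite eqh lexx eqg ltxx => /(_ isT).
- have := rchain_jump axD a0 b0 lt_ji g_fin _ lt_gh.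
  by rewrite eqg lexx eqh ltxx => /(_ isT).
Qed.

(** A potential jump is a crossing point of two monomials, so it is
    determined by the pair of their degrees. *)
Lemma finitely_many_jumps r :
  exists jumps : seq D, forall g, potential_jump r g -> g \in jumps.
Proof.
pose crossing i j g := g != \top%O /\
  g ∙ skew_mono i (skew_coef r i) = g ∙ skew_mono j (skew_coef r j).
pose n := skew_size r.
(* Pairs without a crossing point only add infinity to the list. *)
exists [seq xget \top%O (crossing i j) | i <- iota 0 n, j <- iota 0 n].
move=> g [g_fin [i [j [ne_ij ri rj eq_i eq_j]]]].
have gP : crossing i j g by split; rewrite ?eq_i ?eq_j.
apply/allpairsP; exists (i, j); split;
  rewrite ?mem_iota ?add0n ?skew_coef_lt //=.
have [x_fin x_eq] := xgetI \top%O gP.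
exact: (crossing_unique ri rj ne_ij g_fin x_fin gP.2 x_eq).
Qed.

End Chains.

(** * Values in a valued module *)

Section ValuedModules.

Variables (K : fieldType) (phi : {rmorphism K -> K}) (M : valued_module phi).
Implicit Types (x y z w : M) (r s : skewpoly phi) (g e : vm_chain M).

Local Notation v := (@vm_val K phi M).
Local Notation "g ∙ r" := (rchain_act g r) (at level 40, left associativity).

Let axV := vm_valued M.

Lemma val_topE x : (v x == \top%O) = (x == 0).
Proof. by apply/eqP/eqP => /(valued_top axV). Qed.

Lemma val0 : v 0 = \top%O.
Proof. by apply/(valued_top axV). Qed.

Lemma val_fin x : x != 0 -> v x != \top%O.
Proof. by rewrite val_topE. Qed.

Lemma valN x : v (- x) = v x.
Proof.
have leN y : (v y <= v (- y))%O.
  by have := valued_B axV 0 y; rewrite sub0r val0 min_r ?lex1.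
by apply/eqP; rewrite eq_le leN andbT; have := leN (- x); rewrite opprK.
Qed.

Lemma val_subC x y : v (x - y) = v (y - x).
Proof. by rewrite -valN opprB. Qed.

Lemma valD_ge e x y : (e <= v x)%O -> (e <= v y)%O -> (e <= v (x + y))%O.
Proof.
by move=> ex ey; apply: le_trans (valued_D axV x y); rewrite le_min ex.
Qed.

Lemma valD_gt e x y : (e < v x)%O -> (e < v y)%O -> (e < v (x + y))%O.
Proof.
by move=> ex ey; apply: lt_le_trans (valued_D axV x y); rewrite lt_min ex.
Qed.

Lemma valB_ge e x y : (e <= v x)%O -> (e <= v y)%O -> (e <= v (x - y))%O.
Proof. by move=> ex ey; apply: valD_ge; rewrite ?valN. Qed.

Lemma valB_gt e x y : (e < v x)%O -> (e < v y)%O -> (e < v (x - y))%O.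
Proof. by move=> ex ey; apply: valD_gt; rewrite ?valN. Qed.

Lemma valDl x y : (v x < v y)%O -> v (x + y) = v x.
Proof.
move=> lt_xy; apply/eqP; rewrite eq_le valD_ge ?(ltW lt_xy) // andbT leNgt.
by apply/negP => lt_D; have := valB_gt lt_D lt_xy; rewrite addrK ltxx.
Qed.

Lemma valDr x y : (v y < v x)%O -> v (x + y) = v y.
Proof. by rewrite addrC => /valDl. Qed.

Lemma valBl x y : (v x < v y)%O -> v (x - y) = v x.
Proof. by rewrite -(valN y) => /valDl. Qed.

Lemma val_sum_ge e (I : Type) (t : seq I) (P : pred I) (F : I -> M) :
  (forall i, P i -> (e <= v (F i))%O) -> (e <= v (\sum_(i <- t | P i) F i))%O.
Proof.
by move=> eF; elim/big_ind: _ => // [|x y];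
  [rewrite val0 lex1 | exact: valD_ge].
Qed.

Lemma val_sum_gt e (I : Type) (t : seq I) (P : pred I) (F : I -> M) :
  e != \top%O -> (forall i, P i -> (e < v (F i))%O) ->
  (e < v (\sum_(i <- t | P i) F i))%O.
Proof.
move=> e_fin eF; elim/big_ind: _ => // [|x y]; last exact: valD_gt.
by rewrite val0 lt_neqAle e_fin lex1.
Qed.

Lemma val_mono x i a : v (ract x (skew_mono i a)) = v x ∙ skew_mono i a.
Proof.
rewrite /skew_mono ractM (valued_a axV) -/(skew_mono i a) chain_monoE.
congr (_ ∙ _); elim: i => [|i IH].
  by rewrite expr0 ract1 -[LHS](kchain_act1 (rchain_kchain (rchain_axioms _)))
    skewC1.
by rewrite exprSr ractM (valued_t axV) IH -exprSr chain_exprS.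
Qed.

Lemma ract_monoE x r :
  ract x r = \sum_(i < skew_size r) ract x (skew_mono i (skew_coef r i)).
Proof. by rewrite {1}(skew_monoE r) ract_sum. Qed.

Lemma val_act_ge x r : (v x ∙ r <= v (ract x r))%O.
Proof.
rewrite ract_monoE; apply: val_sum_ge => i _.
have [-> | ri] := eqVneq (skew_coef r i) 0.
  by rewrite skew_mono0 ract0 val0 lex1.
by rewrite val_mono chain_act_le.
Qed.

Lemma regular0 r : regular r (0 : M).
Proof. by rewrite /regular ract0l val0 chain_act_top. Qed.

(** Outside the potential jumps one monomial is strictly dominant. *)
Lemma nonjump_regular x r : r != 0 -> ~ potential_jump r (v x) -> regular r x.
Proof.
move=> r0 no_jump; have [->|x0] := eqVneq x 0; first exact: regular0.
have [i ri eq_i] := chain_act_attained (v x) r0.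
rewrite /regular ract_monoE (bigD1 (Ordinal (skew_coef_lt ri))) //=.
rewrite valDl val_mono // -eq_i; apply: val_sum_gt => [|j ne_ji].
  by rewrite chain_act_fin ?val_fin.
have [-> | rj] := eqVneq (skew_coef r j) 0.
  by rewrite skew_mono0 ract0 val0 lt_neqAle lex1 chain_act_fin ?val_fin.
rewrite val_mono lt_neqAle chain_act_le // andbT; apply/eqP => eq_j.
apply: no_jump; split; first exact: val_fin.
by exists i, j; split; rewrite // eq_sym.
Qed.

Lemma torsion_jump x r :
  r != 0 -> x != 0 -> ract x r = 0 -> potential_jump r (v x).
Proof.
move=> r0 x0 xr; apply: contrapT => /(nonjump_regular r0);
  rewrite /regular xr val0.
by move/esym/eqP; apply/negP; rewrite chain_act_fin ?val_fin.
Qed.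

End ValuedModules.

(** * Regular solvability implies divisibility and maximality *)

Section SolvabilityImplies.

Variables (K : fieldType) (phi : {rmorphism K -> K}) (M : valued_module phi).
Implicit Types (r s : skewpoly phi).

Local Notation "g ∙ r" := (rchain_act g r) (at level 40, left associativity).

Hypothesis solvable : forall (z : M) r, z != 0 -> r != 0 ->
  exists y : M, regular r y /\ ract y r = z.

Lemma regular_solution (z : M) r :
  r != 0 -> exists y : M, regular r y /\ ract y r = z.
Proof.
have [-> r0|] := eqVneq z 0; last exact: solvable.
by exists 0; split; [exact: regular0 | rewrite ract0l].
Qed.

Lemma solvable_residually_divisible : residually_divisible M.
Proof.
have lt_val0 (z : M) : vm_val z != \top%O -> (vm_val z < vm_val (0 : M))%O.
  by move=> z_fin; rewrite val0 lt_neqAle z_fin lex1.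
split=> [z z0|r g [g_fin [i [_ [_ ri _ _ _]]]] _ z vz].
  have [y [_ yz]] := regular_solution z (skewX_neq0 phi).
  by exists y; rewrite yz subrr lt_val0 ?val_fin.
have r0 := skew_coef_neq0 ri.
have [y [y_reg yz]] := regular_solution z r0.
exists y; split; last by rewrite yz subrr lt_val0 // vz chain_act_fin.
by apply: (chain_inj r0); rewrite /= -vz -yz.
Qed.

Section AffineImmediateExtension.

Variables (N : valued_module phi) (f : vm_extension M N).
Hypothesis f_imm : immediate f.

Lemma ext_ract (x : M) r : f (ract x r) = ract (f x) r.
Proof. exact: linearZ. Qed.

(** Induction on the number of potential jumps of r at or above the value of
    w. Immediacy approximates w by some y1 in M; a regular y2 in M with the
    same image under r as w - y1 has at least the value of w - y1, since g
    |-> g . r is increasing. So w - y1 - y2 is torsion of larger value than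
    w, and the jump v(w) is no longer counted. *)
Lemma torsion_in_image (w : N) r : r != 0 -> ract w r = 0 -> exists y, w = f y.
Proof.
move=> r0; have [t jump_t] := finitely_many_jumps (vm_chain N) r.
have {jump_t}: forall g, potential_jump r g -> (vm_val w <= g)%O -> g \in t.
  by move=> g /jump_t.
have [n] := ubnP (size t); elim: n t w => // n IH t w.
rewrite ltnS => le_tn jump_t wr.
have [->|w0] := eqVneq w 0; first by exists 0; rewrite linear0.
have [y1 lt_y1] := f_imm w0; set u := w - f y1 in lt_y1.
have vw : vm_val w = vm_val (f y1) by rewrite -(subrK (f y1) w) valDr.
have [y2 [y2_reg y2r]] := regular_solution (- ract y1 r) r0.
have ur : ract u r = ract (f y2) r.
  by rewrite -ext_ract y2r linearN ractBl wr sub0r ext_ract.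
have le_uy2 : (vm_val u <= vm_val (f y2))%O.
  rewrite -(chain_leE _ _ r0) ext_val -ext_chain_act -y2_reg -ext_val ext_ract.
  by rewrite -ur val_act_ge.
have lt_w : (vm_val w < vm_val (u - f y2))%O.
  by rewrite vw (lt_le_trans lt_y1) // valB_ge.
have w_t : vm_val w \in t by apply: jump_t => //; apply: torsion_jump.
have [y eq_y] : exists y, u - f y2 = f y.
  apply: (IH [seq g <- t | g != vm_val w]).
  - apply: leq_trans le_tn; rewrite size_filter.
    rewrite -(count_predC (pred1 (vm_val w)) t).
    by rewrite -[X in (X < _)%N]add0n ltn_add2r -has_count has_pred1.
  - move=> g g_jump le_g; rewrite mem_filter jump_t ?andbT //.
      by rewrite gt_eqF // (lt_le_trans lt_w).
    by rewrite (le_trans _ le_g) // ltW.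
  - by rewrite ractBl ur subrr.
exists (y + y2 + y1); rewrite !linearD -eq_y /u addrNK.
by rewrite /= subrK.
Qed.

End AffineImmediateExtension.

Lemma solvable_affinely_maximal : affinely_maximal M.
Proof.
move=> N f f_aff f_imm x; have [r r0 [z xz]] := f_aff x.
have [y [_ yz]] := regular_solution z r0.
have [|y' eq_y'] := torsion_in_image f_imm (w := x - f y) r0.
  by rewrite ractBl xz -ext_ract yz subrr.
by exists (y' + y); rewrite linearD -eq_y' subrK.
Qed.

End SolvabilityImplies.

(** * Approximate solutions of one equation *)

Section Approximation.

Variables (K : fieldType) (phi : {rmorphism K -> K}) (M : valued_module phi).
Implicit Types (x y z w : M) (r s : skewpoly phi) (g e : vm_chain M).

Local Notation v := (@vm_val K phi M).
Local Notation "g ∙ r" := (rchain_act g r) (at level 40, left associativity).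

Hypothesis M_div : residually_divisible M.

Let axV := vm_valued M.

(** Iterates the case of t: an approximation of w by y1 . t is refined by an
    approximation of y1, the error of which is multiplied by t. *)
Lemma approx_expr i w : w != 0 ->
  exists y, v y ∙ skewX ^+ i = v w /\ (v w < v (w - ract y (skewX ^+ i)))%O.
Proof.
elim: i w => [|i IH] w w0.
  exists w; rewrite expr0 ract1 subrr val0 lt_neqAle val_fin // lex1 -skewC1.
  by rewrite (kchain_act1 (rchain_kchain (rchain_axioms _))).
have [y1 lt_y1] := M_div.1 w w0.
have vy1 : v y1 ∙ skewX = v w.
  by rewrite -(valued_t axV) -(subrK w (ract y1 skewX)) valDr.
have [y [vy lt_y]] : exists y, v y ∙ skewX ^+ i = v y1 /\
    (v y1 < v (y1 - ract y (skewX ^+ i)))%O.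
  apply: IH; apply: contraNneq w0 => y1_0; rewrite -val_topE -vy1 y1_0 val0.
  by rewrite chain_act_top.
exists y; rewrite chain_exprS vy vy1; split=> //.
rewrite exprSr ractM -[w in X in (_ < X)%O](subrK (ract y1 skewX)) -addrA
  -ractBl.
apply: valD_gt; first by rewrite val_subC.
by rewrite (valued_t axV) -vy1 chain_X_lt.
Qed.

Lemma approx_mono i a w : a != 0 -> w != 0 ->
  exists y, v y ∙ skew_mono i a = v w /\
    (v w < v (w - ract y (skew_mono i a)))%O.
Proof.
move=> a0 w0; pose w' := ract w (skewC a^-1).
have w'a : ract w' (skewC a) = w.
  by rewrite -ractM -skewC_mul mulVf // skewC1 ract1.
have w'0 : w' != 0 by apply: contraNneq w0 => w'0; rewrite -w'a w'0 ract0l.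
have [y [vy lt_y]] := approx_expr i w'0.
exists y; rewrite chain_monoE vy -(valued_a axV) w'a; split=> //.
have -> : w - ract y (skew_mono i a) =
    ract (w' - ract y (skewX ^+ i)) (skewC a) by rewrite ractBl w'a -ractM.
by rewrite (valued_a axV) -[w in v w]w'a (valued_a axV) chain_C_lt.
Qed.

(** Each monomial attains v(w), and the minimum of the monomials attains it
    at the largest of the corresponding arguments. *)
Lemma chain_act_surj r w : r != 0 -> w != 0 -> exists g, g ∙ r = v w.
Proof.
move=> r0 w0.
have [G GP] : exists G : nat -> vm_chain M, forall i, skew_coef r i != 0 ->
    G i ∙ skew_mono i (skew_coef r i) = v w.
  suff /choice[G GP] : forall i, exists g, skew_coef r i != 0 ->
    g ∙ skew_mono i (skew_coef r i) = v w by exists G.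
  move=> i; have [_|ri] := eqVneq (skew_coef r i) 0; first by exists \top%O.
  by have [y [vy _]] := approx_mono i ri w0; exists (v y).
have rn := skew_lead_neq0 r0.
have lt_n : ((skew_size r).-1 < skew_size r)%N by apply: skew_coef_lt.
have := @arg_maxP _ _ _ (Ordinal lt_n) (fun i : 'I__ => skew_coef r i != 0)
  (fun i : 'I__ => G i) rn.
case=> i ri max_i; exists (G i); apply/eqP; rewrite eq_le.
rewrite -{1}(GP _ ri) chain_act_le //=.
have [j rj ->] := chain_act_attained (G i) r0.
have le_G : (G j <= G i)%O := max_i (Ordinal (skew_coef_lt rj)) rj.
by rewrite -(GP _ rj) chain_mono_le.
Qed.

(** The sum of the monomials of r that attain the minimum at g. Its
    monomials all meet at g, hence nowhere else, so it meets the requirement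
    of a unique potential jump in residual divisibility. *)
Definition initial_part g r : skewpoly phi :=
  \poly_(i < skew_size r)
    if g ∙ skew_mono i (skew_coef r i) == g ∙ r then skew_coef r i else 0.

Lemma initial_coef g r i : skew_coef (initial_part g r) i =
  if g ∙ skew_mono i (skew_coef r i) == g ∙ r then skew_coef r i else 0.
Proof.
rewrite [LHS]coef_poly; case: ltnP => // le_i.
by rewrite skew_coef_default // if_same.
Qed.

Lemma initial_coef_neq0 g r i : skew_coef (initial_part g r) i != 0 ->
  skew_coef (initial_part g r) i = skew_coef r i /\
  g ∙ skew_mono i (skew_coef r i) = g ∙ r.
Proof. by rewrite initial_coef; case: ifP => [/eqP|_] //; rewrite eqxx. Qed.

Lemma initial_part_act g r : r != 0 ->
  initial_part g r != 0 /\ g ∙ initial_part g r = g ∙ r.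
Proof.
move=> r0; have [i ri eq_i] := chain_act_attained g r0.
have q0 : initial_part g r != 0.
  by apply: (@skew_coef_neq0 _ _ _ i); rewrite initial_coef -eq_i eqxx.
split=> //; have [j qj ->] := chain_act_attained g q0.
by have [-> ->] := initial_coef_neq0 qj.
Qed.

(** If two monomials of the initial part survive, g is its unique potential
    jump and residual divisibility applies directly; otherwise the initial
    part is a monomial. *)
Lemma approx_initial g r w : r != 0 -> w != 0 -> g ∙ r = v w ->
  exists y, v y = g /\ (v w < v (w - ract y (initial_part g r)))%O.
Proof.
move=> r0 w0 gr; have [q0 gq] := initial_part_act g r0.
set q := initial_part g r in q0 gq *.
have qP k : skew_coef q k != 0 -> skew_coef q k = skew_coef r k /\
  g ∙ skew_mono k (skew_coef r k) = g ∙ r by exact: initial_coef_neq0.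
have g_fin : g != \top%O.
  by apply: contraNneq w0 => g_top; rewrite -val_topE -gr g_top chain_act_top.
have [i qi eq_i] := chain_act_attained g q0.
have [[j [ne_ij qj]]|no_j] := pselect (exists j, i != j /\ skew_coef q j != 0).
  apply: M_div.2; last by rewrite gq gr.
    split=> //; exists i, j; split=> //.
    by rewrite gq; have [-> ->] := qP _ qj.
  move=> h [h_fin [k [l [ne_kl qk ql eq_k eq_l]]]].
  apply: (crossing_unique qk ql ne_kl h_fin g_fin); first by rewrite eq_k.
  have [-> ->] := qP _ qk.
  by have [-> ->] := qP _ ql.
have q_mono : q = skew_mono i (skew_coef q i).
  apply: skew_polyP => k; rewrite skew_coef_mono eq_sym.
  have [-> //|ne_ik] := eqVneq; rewrite mulr0n; apply/eqP/negPn/negP => qk.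
  by apply: no_j; exists k.
have [y [vy lt_y]] := approx_mono i qi w0.
exists y; split; last by rewrite q_mono.
by apply: (@chain_mono_inj _ _ (vm_chain M) i _ qi); rewrite /= vy -eq_i gq.
Qed.

(** At the value of y the monomials outside the initial part only contribute
    terms of value larger than v(w). *)
Lemma approx_solution r w : r != 0 -> w != 0 ->
  exists y, v y ∙ r = v w /\ (v w < v (w - ract y r))%O.
Proof.
move=> r0 w0; have [g gr] := chain_act_surj r0 w0.
have [y [vy lt_y]] := approx_initial r0 w0 gr.
exists y; split; first by rewrite vy.
have -> : w - ract y r =
    (w - ract y (initial_part g r)) - ract y (r - initial_part g r).
  by rewrite ractBr opprB addrA subrK.
rewrite valB_gt // ract_monoE; apply: val_sum_gt => [|i _];
  first exact: val_fin.
have [->|] := eqVneq (skew_coef (r - initial_part g r) i) 0.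
  by rewrite skew_mono0 ract0 val0 lt_neqAle val_fin // lex1.
rewrite val_mono vy skew_coefB initial_coef -gr.
case: ifP => [_|/negbT ne_i]; first by rewrite subrr eqxx.
by rewrite subr0 => ri; rewrite lt_neqAle eq_sym ne_i chain_act_le.
Qed.

End Approximation.

(** * Maximal chains of approximate solutions *)

Lemma subr_subl (V : zmodType) (a b c : V) : (c - a) - (c - b) = b - a.
Proof. by rewrite opprB addrC subrKA. Qed.

Section ApproximatingChains.

Variables (K : fieldType) (phi : {rmorphism K -> K}) (M : valued_module phi).
Variables (z : M) (r : skewpoly phi).
Hypothesis r0 : r != 0.
Implicit Types (x y w m : M) (s q : skewpoly phi) (g e : vm_chain M).

Local Notation v := (@vm_val K phi M).
Local Notation "g ∙ r" := (rchain_act g r) (at level 40, left associativity).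

Definition error y := v (z - ract y r).

(** The relation of two terms of a pseudo-convergent sequence: y' is closer
    to a solution than y, and within the distance that the defect of y
    prescribes. The inequality on the distance is in fact an equality, by
    [improves_val]. *)
Definition improves y y' :=
  (error y <= v (y' - y) ∙ r)%O /\ (error y < error y')%O.

Lemma improves_val y y' : improves y y' -> v (y' - y) ∙ r = error y.
Proof.
case=> le_y lt_y; apply/eqP; rewrite eq_le le_y andbT.
have <- : v (ract (y' - y) r) = error y; last exact: val_act_ge.
transitivity (v ((z - ract y r) - (z - ract y' r))); last exact: valBl.
by rewrite subr_subl ractBl.
Qed.

Lemma improves_trans x y w : improves x y -> improves y w -> improves x w.
Proof.
move=> xy yw; have := improves_val xy; have := improves_val yw.
case: xy yw => _ lt_xy [_ lt_yw] val_yw val_xy.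
split; last exact: lt_trans lt_yw.
have lt_v : (v (y - x) < v (w - y))%O by rewrite -(chain_ltE _ _ r0) val_yw
  val_xy.
by rewrite -(subrK y w) -addrA valDr // val_xy.
Qed.

Lemma improves_irr x : ~ improves x x.
Proof. by case; rewrite ltxx. Qed.

Definition weakly_improves x y := x = y \/ improves x y.

Lemma weakly_improves_le x y : weakly_improves x y -> (error x <= error y)%O.
Proof. by case=> [-> //|[_ /ltW]]. Qed.

Lemma weak_improves_trans x y w :
  weakly_improves x y -> improves y w -> improves x w.
Proof. by case=> [-> //|]; apply: improves_trans. Qed.

Lemma weakly_improves_trans x y w :
  weakly_improves x y -> weakly_improves y w -> weakly_improves x w.
Proof. by move=> xy [<- //|yw]; right; apply: weak_improves_trans xy yw. Qed.

(** The properties of a pseudo-convergent sequence without pseudo-limit, for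
    a chain of arbitrary order type. The last field says that no l is as
    close to every member as a solution would be. *)
Record approximating_chain (C : M -> Prop) : Prop := ApproximatingChain {
  approx_inhabited : exists y, C y;
  approx_total : forall x y, C x -> C y ->
    x = y \/ improves x y \/ improves y x;
  approx_next : forall x, C x -> exists2 y, C y & improves x y;
  approx_no_limit : forall l, exists2 y, C y & (v (l - y) ∙ r < error y)%O
}.

Lemma improvable y : residually_divisible M -> ract y r <> z ->
  exists y', improves y y'.
Proof.
move=> M_div yz; have w0 : z - ract y r != 0 by rewrite subr_eq0;
  apply/eqP/nesym.
have [y' [vy lt_y]] := approx_solution M_div r0 w0.
exists (y + y'); split; first by rewrite (addrC y) addrK vy.
by rewrite /error ractDl opprD addrA.
Qed.

(** A maximal chain among 0 and its improvements. Members other than 0 are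
    regular for r once they are solutions, so none is a solution and each
    can be improved; hence there is no last member. A pseudo-limit would
    improve all members and could be added to the chain. *)
Lemma approximating_chain_exists : residually_divisible M -> z != 0 ->
  (forall y, regular r y -> ract y r <> z) -> exists C, approximating_chain C.
Proof.
move=> M_div z0 no_sol.
pose from0 y := y = 0 \/ improves 0 y.
pose P (A : M -> Prop) :=
  (forall x y, A x -> A y -> x = y \/ improves x y \/ improves y x) /\
  (forall y, A y -> from0 y).
have next y : from0 y -> exists y', improves y y'.
  move=> y_from0; apply: improvable => // yz.
  case: y_from0 => [y0|impr]; first by move: z0; rewrite -yz y0 ract0l eqxx.
  apply: no_sol (yz); rewrite /regular yz; have := improves_val impr.
  by rewrite subr0 /error ract0l subr0 => ->.
have [A [[A_tot A_from0] A_max]] :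
    exists A, P A /\ forall B, (A `<` B)%classic -> ~ P B.
  apply: Zorn_bigcup => F F_P F_tot; split=>
    [x y [A FA Ax] [B FB By]|y [A FA Ay]].
    have [sAB|sBA] := F_tot _ _ FA FB.
      by apply: (F_P B FB).1 => //; apply: sAB.
    by apply: (F_P A FA).1 => //; apply: sBA.
  exact: (F_P A FA).2.
have A_add y : from0 y ->
    (forall x, A x -> x = y \/ improves x y \/ improves y x) -> A y.
  move=> y_from0 y_cmp; apply: contrapT => nAy.
  apply: (A_max (fun x => A x \/ x = y)).
    by split=> [x Ax|sub]; [left | apply/nAy/sub; right].
  split=> [x x' [Ax|->] [Ax'|->]|x [/A_from0//|->//]].
  - exact: A_tot.
  - exact: y_cmp.
  - by case: (y_cmp _ Ax') => [->|[]]; [left | right; right | right; left].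
  - by left.
have A0 : A 0.
  by apply: A_add => [|x /A_from0[]]; [left | left | right; right].
have A_next x : A x -> exists2 y, A y & improves x y.
  move=> Ax; apply: contrapT => no_y.
  have below y : A y -> weakly_improves y x.
    move=> Ay; case: (A_tot _ _ Ax Ay) => [->|[xy|yx]]; [by left| |by right].
    by case: no_y; exists y.
  have [y xy] := next x (A_from0 x Ax).
  have above x' : A x' -> improves x' y.
    by move=> /below/weak_improves_trans; apply.
  apply: no_y; exists y => //; apply: A_add => [|x' /above];
    last by right; left.
  by right; apply: above.
exists A; split=> //; first by exists 0.
move=> l; apply: contrapT => no_y.
have l_lim y : A y -> (error y <= v (l - y) ∙ r)%O.
  by move=> Ay; rewrite leNgt; apply/negP => lt_l; apply: no_y; exists y.
have above y : A y -> improves y l.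
  move=> Ay; split; first exact: l_lim.
  have [y' Ay' [_ lt_y]] := A_next y Ay; apply: lt_le_trans lt_y _.
  have -> : error l = v ((z - ract y' r) - ract (l - y') r).
    by rewrite /error ractBl opprB addrA subrK.
  by rewrite valB_ge // (le_trans (l_lim y' Ay')) // val_act_ge.
have Al : A l.
  by apply: A_add => [|x /above]; [right; apply: above | right; left].
exact: improves_irr (above l Al).
Qed.

End ApproximatingChains.

(** * Stabilization of values along an approximating chain *)

Section EventualValues.

Variables (K : fieldType) (phi : {rmorphism K -> K}) (M : valued_module phi).
Variables (z : M) (r : skewpoly phi).
Hypothesis r0 : r != 0.
Implicit Types (x y w m : M) (s q : skewpoly phi) (g e : vm_chain M).

Local Notation v := (@vm_val K phi M).
Local Notation "g ∙ r" := (rchain_act g r) (at level 40, left associativity).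
Local Notation error := (error z r).
Local Notation improves := (improves z r).
Local Notation weakly_improves := (weakly_improves z r).

Let axV := vm_valued M.

Variable C : M -> Prop.
Hypothesis C_chain : approximating_chain z r C.

Hypothesis solvable_below : forall s, s != 0 -> (skew_size s < skew_size r)%N ->
  forall w, exists y, regular s y /\ ract y s = w.

Lemma approx_directed x y : C x -> C y ->
  exists w, [/\ C w, weakly_improves x w & weakly_improves y w].
Proof.
move=> Cx Cy; case: (approx_total C_chain Cx Cy) => [<-|[xy|yx]].
- by exists x; split=> //; left.
- by exists y; split=> //; [right | left].
- by exists x; split=> //; [left | right].
Qed.

(** For far members of C, a finite set of values is separated into those
    that C has passed and those that it never passes. *)
Lemma approx_cut (t : seq (vm_chain M)) : exists2 y0, C y0 &
  forall g, g \in t -> (g ∙ r < error y0)%O \/ forall y, C y ->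
    (error y <= g ∙ r)%O.
Proof.
elim: t => [|g t [y0 Cy0 y0P]];
  first by have [y Cy] := approx_inhabited C_chain; exists y.
have [g_lim|not_lim] := pselect (forall y, C y -> (error y <= g ∙ r)%O).
  by exists y0 => // h; rewrite inE => /predU1P[->|/y0P //]; right.
have [y1 [Cy1 lt_y1]] : exists y, C y /\ (g ∙ r < error y)%O.
  apply: contrapT => no_y; apply: not_lim => y Cy; rewrite leNgt.
  by apply/negP => lt_y; apply: no_y; exists y.
have [w [Cw le0 le1]] := approx_directed Cy0 Cy1.
exists w => // h; rewrite inE => /predU1P[->|/y0P[lt_h|]]; last by right.
  by left; apply: lt_le_trans lt_y1 (weakly_improves_le le1).
by left; apply: lt_le_trans lt_h (weakly_improves_le le0).
Qed.

(** If it fails, every y in C has a root of x . s = -m as close to y as a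
    limit would be. Each root is left behind by a later member y1 because C
    has no limit, and then differs from the root attached to y1 by an
    s-torsion element, whose value is a potential jump of s that C passes
    arbitrarily late; there are only finitely many such jumps. *)
Lemma approx_leaves_root m s : s != 0 -> (skew_size s < skew_size r)%N ->
  exists x y0, [/\ C y0, ract x s = - m, (v (y0 - x) ∙ r < error y0)%O
                 & regular s (y0 - x)].
Proof.
move=> s0 lt_s; apply: contrapT => no_root.
have root y : C y -> exists2 x, ract x s = - m & (error y <= v (y - x) ∙ r)%O.
  move=> Cy; have [u [u_reg us]] := solvable_below s0 lt_s (m + ract y s).
  have xs : ract (y - u) s = - m by rewrite ractBl us opprD addrCA subrr addr0.
  exists (y - u) => //; rewrite leNgt; apply/negP => lt_y; apply: no_root.
  by exists (y - u), y; rewrite opprB addrC subrK in lt_y *.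
have [t jump_t] := finitely_many_jumps (vm_chain M) s.
have [y0 Cy0 cut_t] := approx_cut t.
have [x0 x0s le0] := root y0 Cy0.
have [y1 Cy1 lt1] := approx_no_limit C_chain x0; rewrite val_subC in lt1.
have [x1 x1s le1] := root y1 Cy1.
(* x0 is farther from y1 than x1 is. *)
have vx : v (x1 - x0) = v (y1 - x0).
  have lt_v : (v (y1 - x0) < v (y1 - x1))%O.
    by rewrite -(chain_ltE _ _ r0) (lt_le_trans lt1).
  by rewrite -(valBl lt_v) subr_subl.
have vx_t : v (y1 - x0) \in t.
  rewrite -vx; apply: jump_t; apply: torsion_jump => //.
    rewrite -val_topE vx; apply: contraTneq lt1 => ->.
    by rewrite chain_act_top -leNgt lex1.
  by rewrite ractBl x1s x0s subrr.
have lt0 : (v (y1 - x0) ∙ r < error y0)%O.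
  by case: (cut_t _ vx_t) => // /(_ y1 Cy1); rewrite leNgt lt1.
case: (approx_total C_chain Cy0 Cy1) => [eq_y|[impr|impr]].
- by move: lt0; rewrite -eq_y ltNge le0.
- move: lt0; rewrite -(improves_val impr) chain_ltE // ltNge.
  have -> : y1 - x0 = (y1 - y0) + (y0 - x0) by rewrite addrA subrK.
  by rewrite valD_ge // -(chain_leE _ _ r0) (improves_val impr).
- move: lt1; rewrite -(improves_val impr) chain_ltE // ltNge.
  have -> : y1 - x0 = (y0 - x0) - (y0 - y1) by rewrite subr_subl.
  rewrite valB_ge // -(chain_leE _ _ r0) (improves_val impr) (le_trans _ le0)
    // ltW //.
  by case: impr.
Qed.

(** With x and y0 from [approx_leaves_root], m + y . s = (y - x) . s, and
    past y0 the part y - x has a constant value lower than that of y - y0.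
    Regularity of y0 - x transfers this comparison through s. *)
Lemma approx_stabilizes m s :
  (m != 0) || (s != 0) -> (skew_size s < skew_size r)%N ->
  exists2 y0, C y0 & forall y, C y -> improves y0 y ->
    (v (m + ract y0 s) < v (ract (y - y0) s))%O.
Proof.
have [->|s0] := eqVneq s 0.
  rewrite orbF => m0 _; have [y0 Cy0] := approx_inhabited C_chain.
  by exists y0 => // y _ _; rewrite !ract0 addr0 val0 lt_neqAle val_fin ?lex1.
move=> _ /(approx_leaves_root m s0)[x [y0 [Cy0 xs lt_x x_reg]]].
exists y0 => // y Cy impr.
have -> : m + ract y0 s = ract (y0 - x) s by rewrite ractBl xs opprK addrC.
rewrite x_reg; apply: lt_le_trans (val_act_ge _ _).
by rewrite chain_ltE // -(chain_ltE _ _ r0) (improves_val impr).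
Qed.

Definition eventual_value m s e := exists2 y0, C y0 &
  forall y, C y -> weakly_improves y0 y -> v (m + ract y s) = e.

Lemma eventual_unique m s e e' :
  eventual_value m s e -> eventual_value m s e' -> e = e'.
Proof.
move=> [y Cy ye] [y' Cy' ye']; have [w [Cw yw yw']] := approx_directed Cy Cy'.
by rewrite -(ye w Cw yw) (ye' w).
Qed.

Lemma eventual_exists m s : (skew_size s < skew_size r)%N ->
  exists e, eventual_value m s e.
Proof.
move=> lt_s; have [|] := boolP ((m != 0) || (s != 0)).
  move=> /approx_stabilizes/(_ lt_s)[y0 Cy0 y0P]; exists (v (m + ract y0 s)).
  exists y0 => // y Cy [<- //|impr].
  have -> : m + ract y s = (m + ract y0 s) + ract (y - y0) s.
    by rewrite -addrA -ractDl subrKC.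
  by rewrite valDl // y0P.
rewrite negb_or !negbK => /andP[/eqP-> /eqP->]; exists \top%O.
have [y Cy] := approx_inhabited C_chain; exists y => // x _ _.
by rewrite ract0 addr0 val0.
Qed.

Lemma eventual_const m : eventual_value m 0 (v m).
Proof.
have [y Cy] := approx_inhabited C_chain; exists y => // x _ _.
by rewrite ract0 addr0.
Qed.

Lemma eventual_D m s e m' s' e' e'' :
  eventual_value m s e -> eventual_value m' s' e' ->
  eventual_value (m + m') (s + s') e'' -> (Order.min e e' <= e'')%O.
Proof.
move=> [x Cx xP] [x' Cx' xP'] [x'' Cx'' xP''].
have [y [Cy xy xy']] := approx_directed Cx Cx'.
have [w [Cw yw xw]] := approx_directed Cy Cx''.
rewrite -(xP w Cw (weakly_improves_trans r0 xy yw)).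
rewrite -(xP' w Cw (weakly_improves_trans r0 xy' yw)) -(xP'' w Cw xw).
by rewrite ractD addrACA (valued_D axV).
Qed.

Lemma eventual_N m s e : eventual_value m s e -> eventual_value (- m) (- s) e.
Proof.
move=> [x Cx xP]; exists x => // y Cy xy.
by rewrite -sub0r -[- s]sub0r ractBr ract0 !sub0r -opprD valN xP.
Qed.

Lemma eventual_C m s e a : eventual_value m s e ->
  eventual_value (ract m (skewC a)) (s * skewC a) (e ∙ skewC a).
Proof.
move=> [x Cx xP]; exists x => // y Cy xy.
by rewrite ractM -ractDl (valued_a axV) xP.
Qed.

(** Reducing m . t + x . (s t) modulo r subtracts x . (r c) and adds z . c,
    which on a member y of C changes the value of an element of eventual
    value e . t by a term of strictly increasing value. If that term stayed
    below e . t, it would be the value of the sum, and not constant. *)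
Lemma eventual_X m s e e' c : eventual_value m s e ->
  eventual_value (ract m skewX + ract z (skewC c))
    (s * skewX - r * skewC c) e' ->
  e' = e ∙ skewX.
Proof.
move=> [x Cx xP] [x' Cx' xP'].
have [y0 [Cy0 xy0 xy0']] := approx_directed Cx Cx'.
have [y1 Cy1 y01] := approx_next C_chain Cy0.
have [y2 Cy2 y12] := approx_next C_chain Cy1.
have y02 := improves_trans r0 y01 y12.
pose A y := ract (m + ract y s) skewX.
pose B y := ract (z - ract y r) (skewC c).
have vA y : C y -> weakly_improves y0 y -> v (A y) = e ∙ skewX.
  by move=> Cy y0y; rewrite (valued_t axV) xP //;
    apply: (weakly_improves_trans r0 xy0).
have vAB y : C y -> weakly_improves y0 y -> v (A y + B y) = e'.
  move=> Cy y0y; rewrite -(xP' y Cy (weakly_improves_trans r0 xy0' y0y)).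
  by rewrite /A /B ractBr !ractM ractDl ractBl addrACA addrA.
have [c0|c0] := eqVneq c 0.
  rewrite -(vAB y0 Cy0) -?(vA y0 Cy0); try by left.
  by rewrite /B c0 skewC0 ract0 addr0.
have B_lt y y' : improves y y' -> (v (B y) < v (B y'))%O.
  by case=> _ lt_y; rewrite !(valued_a axV) chain_C_lt.
(* If B y2 does not exceed the value of A, then B y0 and B y1 are strictly
   below it and both have value e', although they differ. *)
have [lt_A|le_B] := ltP (e ∙ skewX) (v (B y2)).
  by rewrite -(vAB y2 Cy2) ?valDl ?vA //; right.
have vB y : C y -> weakly_improves y0 y -> improves y y2 -> v (B y) = e'.
  move=> Cy y0y yy2; rewrite -(vAB y Cy y0y) valDr // vA //.
  exact: lt_le_trans (B_lt _ _ yy2) le_B.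
have := B_lt _ _ y01; rewrite (vB y0) ?(vB y1) ?ltxx //; first by right.
by left.
Qed.

(** The content of immediacy of the extension: the element m + x . s of M
    approximates the adjoined element with a strictly larger error value,
    and in particular the eventual value e is finite. *)
Lemma better_constant_approximation m s e :
  (m != 0) || (s != 0) -> (skew_size s < skew_size r)%N ->
  eventual_value m s e -> exists x e',
    [/\ v (m + ract x s) = e, (e < e')%O & eventual_value (- ract x s) s e'].
Proof.
move=> ms0 lt_s [x Cx xP]; have [y0 Cy0 y0P] := approx_stabilizes ms0 lt_s.
have [y [Cy xy y0y]] := approx_directed Cx Cy0.
have [y' Cy' yy'] := approx_next C_chain Cy.
have [e' ee'] := eventual_exists (- ract y0 s) lt_s.
have vy0 : v (m + ract y0 s) = e.
  have xy' : weakly_improves x y' by right; apply: weak_improves_trans xy yy'.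
  have lt_y0 : (v (m + ract y0 s) < v (ract (y' - y0) s))%O.
    by apply: y0P => //; apply: weak_improves_trans y0y yy'.
  by rewrite -(xP y' Cy' xy') -(valDl lt_y0) -addrA -ractDl subrKC.
exists y0, e'; split=> //; have [y1 Cy1 y1P] := ee'.
have [w [Cw y0w y1w]] := approx_directed Cy0 Cy1.
have [w' Cw' ww'] := approx_next C_chain Cw.
rewrite -(y1P w' Cw'); last by right; apply: weak_improves_trans y1w ww'.
rewrite -vy0 (addrC (- _)) -ractBl y0P //; exact: weak_improves_trans y0w ww'.
Qed.

End EventualValues.

(** * The quotient of a module by a cyclic submodule *)

Section CyclicQuotient.

Variables (R : nzRingType) (V : lmodType R) (e : V).
Local Open Scope quotient_scope.

Definition multiples : {pred V} := [pred x | `[< exists a : R, x = a *: e >]].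

Lemma multiplesP x : reflect (exists a : R, x = a *: e) (x \in multiples).
Proof. exact: asboolP. Qed.

Fact multiples_zmod_closed : zmod_closed multiples.
Proof.
split=> [|_ _ /multiplesP[a ->] /multiplesP[b ->]]; apply/multiplesP.
  by exists 0; rewrite scale0r.
by exists (a - b); rewrite scalerBl.
Qed.

HB.instance Definition _ :=
  GRing.isZmodClosed.Build V multiples multiples_zmod_closed.

Definition quotient_module : Type := Quotient.quot multiples.
HB.instance Definition _ := GRing.Zmodule.on quotient_module.

Definition quotient_map (x : V) : quotient_module :=
  \pi_(Quotient.quot multiples) x.

Definition quotient_scale (a : R) (w : quotient_module) : quotient_module :=
  quotient_map (a *: repr (w : Quotient.quot multiples)).

Lemma quotient_eqP x y :
  quotient_map x = quotient_map y <-> x - y \in multiples.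
Proof. by rewrite Quotient.idealrBE; split=> /eqP. Qed.

Lemma quotient_onto w : exists x, w = quotient_map x.
Proof.
by exists (repr (w : Quotient.quot multiples)); rewrite /quotient_map reprK.
Qed.

Lemma quotient_mapD x y :
  quotient_map (x + y) = quotient_map x + quotient_map y.
Proof. by rewrite /quotient_map !piE. Qed.

Lemma quotient_mapZ a x :
  quotient_map (a *: x) = quotient_scale a (quotient_map x).
Proof.
apply/quotient_eqP; rewrite -scalerBr.
have /quotient_eqP/multiplesP[b ->] :
    quotient_map x =
      quotient_map (repr (quotient_map x : Quotient.quot multiples)).
  by rewrite /quotient_map reprK.
by apply/multiplesP; exists (a * b); rewrite scalerA.
Qed.

Fact quotient_scaleA a b w :
  quotient_scale a (quotient_scale b w) = quotient_scale (a * b) w.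
Proof. by have [x ->] := quotient_onto w; rewrite -!quotient_mapZ scalerA. Qed.

Fact quotient_scale1 : left_id 1 quotient_scale.
Proof.
by move=> w; have [x ->] := quotient_onto w; rewrite -quotient_mapZ scale1r.
Qed.

Fact quotient_scaleDr : right_distributive quotient_scale +%R.
Proof.
move=> a w w'; have [x ->] := quotient_onto w; have [x' ->] := quotient_onto w'.
by rewrite -quotient_mapD -!quotient_mapZ scalerDr quotient_mapD.
Qed.

Fact quotient_scaleDl w : {morph quotient_scale^~ w : a b / a + b}.
Proof.
move=> a b; have [x ->] := quotient_onto w.
by rewrite -!quotient_mapZ scalerDl quotient_mapD.
Qed.

HB.instance Definition _ := GRing.Zmodule_isLmodule.Build R quotient_module
  quotient_scaleA quotient_scale1 quotient_scaleDr quotient_scaleDl.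

Lemma quotient_map_linear : linear quotient_map.
Proof. by move=> a x y; rewrite quotient_mapD quotient_mapZ. Qed.

HB.instance Definition _ :=
  GRing.isLinear.Build R V quotient_module _ quotient_map quotient_map_linear.

End CyclicQuotient.

(** * The module generated by a formal solution *)

Section AdjoinedSolution.

Variables (K : fieldType) (phi : {rmorphism K -> K}).
Variables (M : lmodType (skewpoly phi)^c) (z : M) (r : skewpoly phi).
Implicit Types (m : M) (s q : skewpoly phi).

(** The regular module over the converse ring is R as a right module over
    itself. *)
Definition pairs : lmodType (skewpoly phi)^c := (M * ((skewpoly phi)^c)^o)%type.

Definition adjoined : lmodType (skewpoly phi)^c :=
  quotient_module ((- z, r) : pairs).

Definition adj m s : adjoined :=
  quotient_map ((- z, r) : pairs) ((m, s) : pairs).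

Lemma adj_eqP m s m' s' : adj m s = adj m' s' <->
  exists q, m - m' = - ract z q /\ s - s' = r * q.
Proof.
rewrite /adj quotient_eqP; split=> [/multiplesP[q [eq_m eq_s]]|[q [eq_m eq_s]]].
  by exists q; split; rewrite ?eq_m ?eq_s // -ractNl.
by apply/multiplesP; exists q; congr (_, _); rewrite ?eq_m // -ractNl.
Qed.

Lemma adj_onto w : exists m s, w = adj m s.
Proof. by have [[m s] ->] := quotient_onto w; exists m, s. Qed.

Lemma adjD m s m' s' : adj (m + m') (s + s') = adj m s + adj m' s'.
Proof. exact: (quotient_mapD ((- z, r) : pairs) (m, s) (m', s')). Qed.

Lemma adj_ract m s q : ract (adj m s) q = adj (ract m q) (s * q).
Proof. by rewrite /ract -linearZ. Qed.

Lemma adj_sum (I : Type) (t : seq I) (F : I -> M) (G : I -> skewpoly phi) :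
  \sum_(i <- t) adj (F i) (G i) = adj (\sum_(i <- t) F i) (\sum_(i <- t) G i).
Proof.
elim: t => [|i t IH]; last by rewrite !big_cons IH adjD.
by rewrite !big_nil; apply: (addIr (adj 0 0)); rewrite -adjD !add0r.
Qed.

Definition adj_emb m : adjoined := adj m 0.

Fact adj_emb_linear : linear adj_emb.
Proof.
move=> q x y; rewrite /adj_emb -[X in adj _ X](addr0 0) adjD.
by rewrite -[X in adj _ X + _](mul0r (q : skewpoly phi)) -adj_ract.
Qed.

HB.instance Definition _ :=
  GRing.isLinear.Build (skewpoly phi)^c M adjoined _ adj_emb adj_emb_linear.

End AdjoinedSolution.

(** * The valuation of the adjoined solution *)

Section AdjoinedValuation.

Variables (K : fieldType) (phi : {rmorphism K -> K}) (M : valued_module phi).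
Variables (z : M) (r : skewpoly phi).
Hypothesis r0 : r != 0.
Implicit Types (x y m : M) (s q : skewpoly phi) (e : vm_chain M).
Implicit Types (w : adjoined z r).

Local Notation v := (@vm_val K phi M).
Local Notation "g ∙ r" := (rchain_act g r) (at level 40, left associativity).
Local Notation adj := (adj z r).

Variable C : M -> Prop.
Hypothesis C_chain : approximating_chain z r C.

Hypothesis solvable_below : forall s, s != 0 -> (skew_size s < skew_size r)%N ->
  forall x, exists y, regular s y /\ ract y s = x.

Local Notation eventual_value := (eventual_value z r C).

Lemma adj_reduce m s q : adj m s = adj (m + ract z q) (s - r * q).
Proof. by apply/adj_eqP; exists q; rewrite opprD addNKr opprB subrKC. Qed.

Lemma reduced_representative w :
  exists m s, (skew_size s < skew_size r)%N /\ w = adj m s.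
Proof.
have [m [s ->]] := adj_onto w; have [q lt_q] := skew_division s r0.
by exists (m + ract z q), (s - r * q); rewrite -adj_reduce.
Qed.

(** A difference in r R of degree less than that of r vanishes. *)
Lemma reduced_unique m s m' s' :
  (skew_size s < skew_size r)%N -> (skew_size s' < skew_size r)%N ->
  adj m s = adj m' s' -> m = m' /\ s = s'.
Proof.
move=> lt_s lt_s' /adj_eqP[q [eq_m eq_s]].
have q0 : q = 0.
  apply/eqP/negPn/negP => /(skew_size_mul r); apply/negP.
  by rewrite -eq_s -ltnNge skew_sizeD ?skew_sizeN.
split; apply/eqP; rewrite -subr_eq0 ?eq_m ?eq_s q0 ?ract0 ?oppr0 ?mulr0 //.
Qed.

(** Reduced representatives are unique and have a unique eventual value, so
    the choice below ranges over a single value. *)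
Definition adj_val w : vm_chain M :=
  xget \top%O (fun e => exists m s,
    [/\ (skew_size s < skew_size r)%N, w = adj m s & eventual_value m s e]).

Lemma adj_valE m s e : (skew_size s < skew_size r)%N ->
  eventual_value m s e -> adj_val (adj m s) = e.
Proof.
move=> lt_s ev; apply: xget_unique; first by exists m, s.
move=> e' [m' [s' [lt_s' /(reduced_unique lt_s lt_s')[<- <-] ev']]].
exact: eventual_unique ev' ev.
Qed.

Lemma reduced_value w : exists m s,
  [/\ (skew_size s < skew_size r)%N,
    w = adj m s & eventual_value m s (adj_val w)].
Proof.
have [m [s [lt_s ->]]] := reduced_representative w; exists m, s; split=> //.
have [e ev] := eventual_exists r0 C_chain solvable_below m lt_s.
by rewrite (adj_valE lt_s ev).
Qed.

Lemma adj_val_emb m : adj_val (adj_emb z r m) = v m.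
Proof.
by apply: adj_valE; [rewrite skew_size0 skew_size_gt0 | exact: eventual_const].
Qed.

Lemma adj0 : adj 0 0 = 0.
Proof. exact: (linear0 (adj_emb z r)). Qed.

Lemma adjN m s : adj (- m) (- s) = - adj m s.
Proof. by apply/eqP; rewrite -subr_eq0 opprK -adjD !addNr adj0. Qed.

Fact adj_val_top w : adj_val w = \top%O <-> w = 0.
Proof.
split=> [|->]; last by rewrite -[0](linear0 (adj_emb z r)) adj_val_emb val0.
have [m [s [lt_s -> ev]]] := reduced_value w.
have [ms0|] := boolP ((m != 0) || (s != 0)).
  have [x [e' [_ lt_e _]]] := better_constant_approximation r0 C_chain
    solvable_below ms0 lt_s ev.
  by move=> e_top; have := lt_fin lt_e; rewrite e_top eqxx.
by rewrite negb_or !negbK => /andP[/eqP-> /eqP->]; rewrite adj0.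
Qed.

Lemma adj_valN w : adj_val (- w) = adj_val w.
Proof.
have [m [s [lt_s eq_w ev]]] := reduced_value w.
rewrite {1}eq_w -adjN; apply: adj_valE; last exact: eventual_N.
by rewrite skew_sizeN.
Qed.

Fact adj_valD w w' : (Order.min (adj_val w) (adj_val w') <= adj_val (w + w'))%O.
Proof.
have [m [s [lt_s eq_w ev]]] := reduced_value w.
have [m' [s' [lt_s' eq_w' ev']]] := reduced_value w'.
have lt_ss' : (skew_size (s + s')%R < skew_size r)%N.
  exact: skew_sizeD.
have [e ev_e] := eventual_exists r0 C_chain solvable_below (m + m') lt_ss'.
have -> : adj_val (w + w') = e by rewrite eq_w eq_w' -adjD; apply: adj_valE.
exact: (eventual_D r0 C_chain ev ev' ev_e).
Qed.

Fact adj_val_C w a : adj_val (ract w (skewC a)) = adj_val w ∙ skewC a.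
Proof.
have [m [s [lt_s eq_w ev]]] := reduced_value w.
rewrite {1}eq_w adj_ract; apply: adj_valE; last exact: eventual_C.
exact: leq_ltn_trans (skew_size_mulC _ _) lt_s.
Qed.

Fact adj_val_X w : adj_val (ract w skewX) = adj_val w ∙ skewX.
Proof.
have [m [s [lt_s eq_w ev]]] := reduced_value w.
have [|c] := @skew_cancel_lead _ _ r (s * skewX) 0 r0.
  by rewrite addn0 (leq_trans (skew_size_mulX s)).
rewrite addn0 /skew_mono expr0 mul1r => lt_c.
rewrite {1}eq_w adj_ract (adj_reduce _ _ (skewC c)).
have [e ev_e] := eventual_exists r0 C_chain solvable_below
  (ract m skewX + ract z (skewC c)) lt_c.
by rewrite (adj_valE lt_c ev_e); apply: (eventual_X r0 C_chain ev ev_e).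
Qed.

Fact adj_valued : is_valued adj_val.
Proof.
split.
- move=> e; have [x <-] := valued_surj (vm_valued M) e.
  by exists (adj_emb z r x); apply: adj_val_emb.
- exact: adj_valD.
- by move=> w w'; rewrite -(adj_valN w') adj_valD.
- exact: adj_val_top.
- exact: adj_val_C.
- exact: adj_val_X.
Qed.

Definition adjoined_valued : valued_module phi := ValuedModule adj_valued.

Fact adj_emb_inj : injective (adj_emb z r).
Proof.
have lt0 : (skew_size (0%R : skewpoly phi) < skew_size r)%N.
  by rewrite skew_size0 skew_size_gt0.
by move=> x y /(reduced_unique lt0 lt0)[].
Qed.

Definition adjoined_extension : vm_extension M adjoined_valued :=
  @VMExtension K phi M adjoined_valued (adj_emb z r) id adj_emb_inj
    (fun g h => erefl) erefl (fun g q => erefl) adj_val_emb.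

Lemma adjoined_immediate : immediate adjoined_extension.
Proof.
move=> w w0; have [m [s [lt_s eq_w ev]]] := reduced_value w.
have ms0 : (m != 0) || (s != 0).
  apply: contraNT w0; rewrite negb_or !negbK eq_w => /andP[/eqP-> /eqP->].
  by rewrite adj0.
have [x [e' [val_e lt_e ev']]] :=
  better_constant_approximation r0 C_chain solvable_below ms0 lt_s ev.
exists (m + ract x s); change (adj_val (adj_emb z r (m + ract x s)) <
  adj_val (w - adj_emb z r (m + ract x s)))%O.
rewrite adj_val_emb val_e {2}eq_w /adj_emb -adjN -adjD opprD addNKr oppr0 addr0.
by rewrite (adj_valE lt_s ev').
Qed.

(** The elements w . t^i for i < deg r + 1 have reduced representatives
    whose second components lie in a K-space of dimension deg r; a linear
    dependency among these components is a multiplier sending w to M. *)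
Lemma adjoined_affine : affine adjoined_extension.
Proof.
move=> w; set n := skew_size r.
have n_gt0 : (0 < n)%N by rewrite skew_size_gt0.
have /choice[F FP] : forall i, exists ms : M * skewpoly phi,
    (skew_size ms.2 < n)%N /\ ract w (skewX ^+ i) = adj ms.1 ms.2.
  move=> i; have [m [s [lt_s eq_w]]] :=
    reduced_representative (ract w (skewX ^+ i)).
  by exists (m, s).
pose A : 'M[K]_(n, n.-1) := \matrix_(i, j) skew_coef (F i).2 j.
have: kermx A != 0.
  rewrite kermx_eq0 /row_free; apply: contraTN (rank_leq_col A) => /eqP->.
  by rewrite -ltnNge prednK.
case/rowV0Pn => c /sub_kermxP cA c0.
pose q : skewpoly phi := \sum_(i < n) skew_mono i (c 0 i).
have q_coef (i : 'I_n) : skew_coef q i = c 0 i.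
  rewrite skew_coef_sum (bigD1 i) //= big1 ?addr0 => [|j ne_ji].
    by rewrite skew_coef_mono eqxx.
  by rewrite skew_coef_mono eq_sym val_eqE (negPf ne_ji).
exists q.
  apply: contraNneq c0 => q0; apply/eqP/rowP => i.
  by rewrite mxE -q_coef q0 skew_coef0.
exists (\sum_(i < n) ract (F i).1 (skewC (c 0 i))).
rewrite /= /adj_emb (_ : 0 = \sum_(i < n) (F i).2 * skewC (c 0 i)).
  rewrite -adj_sum ract_sum; apply: eq_bigr => i _.
  by rewrite /skew_mono ractM (FP i).2 adj_ract.
apply: skew_polyP => k; rewrite skew_coef0 skew_coef_sum.
have [lt_k|le_k] := ltnP k n.-1.
  have /matrixP/(_ 0 (Ordinal lt_k)) := cA; rewrite !mxE => cA_k.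
  by rewrite -[LHS]cA_k; apply: eq_bigr => i _;
    rewrite mul_skewC_coef mulrC mxE.
rewrite big1 // => i _; rewrite mul_skewC_coef skew_coef_default ?mul0r //.
by rewrite (leq_trans _ le_k) // -ltnS prednK // (FP i).1.
Qed.

Lemma adjoined_proper x : (1 < skew_size r)%N -> adj 0 1 <> adj_emb z r x.
Proof.
move=> r_gt1 /(reduced_unique _ _)[];
  rewrite ?skew_size1 ?skew_size0 ?skew_size_gt0 //.
by move=> _ /eqP; rewrite (negPf (oner_neq0 _)).
Qed.

End AdjoinedValuation.

(** Induction on the degree; constants are units. *)
Lemma maximal_solvable (K : fieldType) (phi : {rmorphism K -> K})
    (M : valued_module phi) :
  residually_divisible M -> affinely_maximal M ->
  forall (r : skewpoly phi) (z : M), r != 0 ->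
    exists y : M, regular r y /\ ract y r = z.
Proof.
move=> M_div M_max r z; have [n] := ubnP (skew_size r).
elim: n r z => // n IH r z; rewrite ltnS => le_rn r0.
have [->|z0] := eqVneq z 0.
  by exists 0; split; [exact: regular0 | rewrite ract0l].
have [r_gt1|r_le1] := ltnP 1 (skew_size r); last first.
  have sz_r : skew_size r = 1%N.
    by apply/eqP; rewrite eqn_leq r_le1 skew_size_gt0.
  have rC := skew_size1E sz_r; set a := skew_coef r 0 in rC.
  have a0 : a != 0 by apply: contraNneq r0 => a0; rewrite rC a0 skewC0.
  exists (ract z (skewC a^-1)); rewrite /regular rC.
  split; first by rewrite (valued_a (vm_valued M)).
  by rewrite -ractM -skewC_mul mulVf // skewC1 ract1.
apply: contrapT => no_sol.
have [C C_chain] : exists C, approximating_chain z r C.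
  by apply: approximating_chain_exists => // y y_reg yz; apply: no_sol;
    exists y.
have solvable_below s : s != 0 -> (skew_size s < skew_size r)%N ->
    forall x : M, exists y, regular s y /\ ract y s = x.
  by move=> s0 lt_s x; apply: IH => //; apply: leq_trans lt_s le_rn.
pose f := adjoined_extension r0 C_chain solvable_below.
have f_aff : affine f by exact: adjoined_affine.
have f_imm : immediate f by exact: adjoined_immediate.
have [y] := M_max _ f f_aff f_imm (adj z r 0 1).
exact: adjoined_proper.
Qed.

Theorem theorem3p35 (K : fieldType) (phi : {rmorphism K -> K})
    (phi_order : not_finite_order phi) (M : valued_module phi) :
  (residually_divisible M /\ affinely_maximal M <->
     forall (z : M) (r : skewpoly phi), z != 0 -> r != 0 ->
       exists y : M, regular r y /\ ract y r = z) /\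
  (residually_divisible M /\ affinely_maximal M -> divisible M).
Proof.
split; last first.
  move=> [M_div M_max] r r0 z.
  by have [y [_ yz]] := maximal_solvable M_div M_max z r0; exists y.
split=> [[M_div M_max] z r _ r0|M_solv].
  exact: maximal_solvable.
split; [exact: solvable_residually_divisible |
  exact: solvable_affinely_maximal].
Qed.
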